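(* Let $f$ be a function on $\mathbb R$ whose Fourier transform vanishes for negative arguments, normalised ($\int_0^\infty\frac{dp}{2p}|\tilde f(p)|^2=1$), such that $f$ and its derivative $f'$ exist and are integrable, and suppose there are constants $C>0$, $L\ge1$, $\alpha>1/2$ with $|f(y)|\le C/y^{1+\alpha}$ for $y\ge L$. Let $f_{y_o}(y)=f(y-y_o)$. Then for every $y_o\le -4(1+L)$, \[ \bar N[f_{y_o}]\le \frac{1}{\alpha(2\alpha-1)}\,\frac{8C^2}{(-y_o/4+L/2-1)^{2\alpha-1}}+20\,e^{4L+y_o/2}\big(2^{1+\alpha}C+\|f\|_{L^1}+\|f'\|_{L^1}\big)^2.\]
   Context: Fourier transforms: $\tilde g(p)=(2\pi)^{-1/2}\int g(y)e^{-ipy}dy$. With $x(y)=-\log(1+e^{-y})$, $\widetilde{\check f}(-k)=(2\pi)^{-1/2}\int_{\mathbb R} f(y)e^{ikx(y)}dy$ for $k\ge0$, and the mean number of created particles is $\bar N[f]=\int_0^\infty\frac{dk}{2k}|\widetilde{\check f}(-k)|^2$. *)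

(* Defs.v *)
From HB Require Import structures.
From mathcomp Require Import all_boot all_order all_algebra.
From mathcomp Require Import all_classical all_reals all_analysis.
Set Implicit Arguments. Unset Strict Implicit. Unset Printing Implicit Defensive.
Import Order.TTheory GRing.Theory Num.Theory.
Import numFieldNormedType.Exports.
Local Open Scope classical_set_scope.
Local Open Scope ring_scope.

(* A complex-valued function g : R -> C is represented by its real part gr
   and imaginary part gi, both R -> R. *)
Section Defs.
Variable R : realType.
Local Notation mu := (@lebesgue_measure R).

(* Fourier transform  g~(p) = (2 pi)^(-1/2) \int g(y) e^{-ipy} dy  *)
Definition FT_re (gr gi : R -> R) (p : R) : R :=
  (Num.sqrt (2 * pi))^-1 *
  Rintegral mu setT (fun y => gr y * cos (p * y) + gi y * sin (p * y)).
Definition FT_im (gr gi : R -> R) (p : R) : R :=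
  (Num.sqrt (2 * pi))^-1 *
  Rintegral mu setT (fun y => gi y * cos (p * y) - gr y * sin (p * y)).

Definition xmap (y : R) : R := - ln (1 + expR (- y)).

(* (g check)~(-k) = (2 pi)^(-1/2) \int g(y) e^{i k x(y)} dy *)
Definition Bog_re (gr gi : R -> R) (k : R) : R :=
  (Num.sqrt (2 * pi))^-1 *
  Rintegral mu setT (fun y => gr y * cos (k * xmap y) - gi y * sin (k * xmap y)).
Definition Bog_im (gr gi : R -> R) (k : R) : R :=
  (Num.sqrt (2 * pi))^-1 *
  Rintegral mu setT (fun y => gi y * cos (k * xmap y) + gr y * sin (k * xmap y)).

Definition half_inv_int (Fre Fim : R -> R) : \bar R :=
  (\int[mu]_(p in `]0%R, +oo[) ((2 * p)^-1 * (Fre p ^+ 2 + Fim p ^+ 2))%:E)%E.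

Definition KG_norm (gr gi : R -> R) : \bar R :=
  half_inv_int (FT_re gr gi) (FT_im gr gi).

(* mean number of created particles N[g] *)
Definition Nbar (gr gi : R -> R) : \bar R :=
  half_inv_int (Bog_re gr gi) (Bog_im gr gi).

Definition L1norm (gr gi : R -> R) : R :=
  Rintegral mu setT (fun y => Num.sqrt (gr y ^+ 2 + gi y ^+ 2)).

Definition cintegrable (gr gi : R -> R) : Prop :=
  mu.-integrable setT (EFin \o gr) /\ mu.-integrable setT (EFin \o gi).

Definition fshift (g : R -> R) (yo : R) : R -> R := fun y => g (y - yo).

End Defs.

(* Main.v *)
(** Put T = - yo and f_yo(y) = f(y + T).  Since x(y) = y - ln (1 + e^y), the phase
    k x(y) is close to k y wherever y is very negative, and there the transform of
    f_yo at -k is compared with the Fourier transform of f at -k, which vanishes.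

    Let b = T / 2, z = y + T, and let H(k) be the integral of f(z) e^(i k x(z - T)).
    - For k <= e^(b/2), subtract the vanishing Fourier integral.  On z <= b the
      phases differ by at most k e^(-b); on z >= b the difference of exponentials
      is at most 2, and at most 2 (k z)^(1/4), against the decay C z^(-1-alpha).
      The exponent 1/4 makes the k-integral converge at 0.
    - For k >= e^(b/2), cut at Z(k) = b/2 + (ln k)/2.  Integrating by parts on
      z <= Z(k) gains 1/k and loses e^(Z(k) - T), leaving O(k^(-1/2)); beyond Z(k)
      the integral is at most C Z(k)^(-alpha) / alpha, whose square is integrable
      against dk/k because 2 alpha > 1.
    As f' is only integrable, integration by parts rests on the inequality
    |F(b) - F(a)| <= int_a^b G for F differentiable everywhere with |F'| <= G. *)

Require Import Defs.
From HB Require Import structures.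
From mathcomp Require Import all_boot all_order all_algebra.
From mathcomp Require Import all_classical all_reals all_analysis.
From mathcomp Require Import measurable_realfun ring lra.
Set Implicit Arguments. Unset Strict Implicit. Unset Printing Implicit Defensive.
Import Order.TTheory GRing.Theory Num.Theory.
Import numFieldNormedType.Exports.
Local Open Scope classical_set_scope.
Local Open Scope ring_scope.
Local Notation mu := lebesgue_measure.

(** * Increments of everywhere differentiable functions *)

(* The supremum of the points where the estimate already holds belongs to this set
   by the left condition and is b by the right one. *)
Lemma increment_le_measure_local (R : realType)
    (m : {measure set (measurableTypeR R) -> \bar R}) (F : R -> R) (a b : R) :
  a <= b ->
  (forall x, a <= x <= b -> exists2 r, 0 < r & forall t, a <= t <= b ->
     `|t - x| < r -> x < t -> (`|F t - F x|%:E <= m `]x, t]%classic)%E) ->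
  (forall x, a <= x <= b -> exists2 r, 0 < r & forall t, a <= t <= b ->
     `|t - x| < r -> t < x -> (`|F x - F t|%:E <= m `]t, x]%classic)%E) ->
  (`|F b - F a|%:E <= m `]a, b]%classic)%E.
Proof.
move=> ab right_loc left_loc.
pose S := [set x | a <= x <= b /\ (`|F x - F a|%:E <= m `]a, x]%classic)%E].
have Sa : S a by split; [rewrite lexx|rewrite subrr normr0 measure_ge0].
have Sb x : S x -> x <= b by case=> /andP[].
have hS : has_sup S by split; [exists a|exists b => x /Sb].
have ac : a <= sup S by apply: sup_upper_bound.
have cb : sup S <= b by apply: ge_sup => //; exists a.
(* By additivity of [m], estimates on adjacent half-open intervals combine; both steps at the
   supremum rest on this. *)
have chain x y : a <= x -> x <= y -> (`|F x - F a|%:E <= m `]a, x]%classic)%E ->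
    (`|F y - F x|%:E <= m `]x, y]%classic)%E -> (`|F y - F a|%:E <= m `]a, y]%classic)%E.
  move=> ax xy Hx Hy.
  have -> : `]a, y]%classic = `]a, x] `|` `]x, y].
    by rewrite -itv_bndbnd_setU// ?bnd_simp.
  rewrite measureU//=; last first.
    apply/seteqP; split => // z [] /=; rewrite !in_itv/= => /andP[_ zx].
    by move=> /andP[xz _]; have := lt_le_trans xz zx; rewrite ltxx.
  rewrite (le_trans _ (leeD Hx Hy))// -EFinD lee_fin.
  by have := ler_normD (F x - F a) (F y - F x); congr (`|_| <= _); lra.
have Sc : S (sup S).
  split; first by rewrite ac.
  have [r r0 Hr] := left_loc (sup S) (introT andP (conj ac cb)).
  have [x [/andP[ax xb] Sx] cx] := sup_adherent r0 hS.
  have xc : x <= sup S by apply: sup_upper_bound => //; split; rewrite ?ax.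
  have [->//|xnc] := eqVneq (sup S) x.
  have {}xc : x < sup S by rewrite lt_neqAle eq_sym xnc.
  apply: (chain x) => //; first exact: ltW.
  apply: Hr => //; first by rewrite ax.
  rewrite ltr0_norm ?subr_lt0// opprB ltrBlDr -ltrBlDl. exact: cx.
have [bc|bc] := leP b (sup S).
  have <- : sup S = b by apply/eqP; rewrite eq_le cb bc.
  by case: Sc.
have [r r0 Hr] := right_loc (sup S) (introT andP (conj ac cb)).
(* Half the radius, capped at [b], yields a point of [S] strictly above the supremum, which is
   absurd. *)
pose t := Num.min (sup S + r / 2) b.
have ct : sup S < t by rewrite lt_min bc andbT ltrDl divr_gt0.
have tb : t <= b by rewrite ge_min lexx orbT.
have tr : t <= sup S + r / 2 by rewrite ge_min lexx.
have : S t.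
  split; first by rewrite tb (le_trans ac)// ltW.
  apply: (chain (sup S)) => //; [exact: ltW|by case: Sc|].
  apply: Hr => //; first by rewrite tb (le_trans ac)// ltW.
  by rewrite gtr0_norm ?subr_gt0//; lra.
by move/(sup_upper_bound hS); rewrite leNgt ct.
Qed.

(** The difference quotient is eventually within [e] of [l]. Multiplying through by t - x gives a
    form that also covers t = x, where the quotient says nothing. *)
Lemma is_derive_increment_le (R : realType) (F : R -> R) (x l e : R) :
  is_derive x 1 F l -> 0 < e ->
  exists2 r, 0 < r & forall t, `|t - x| < r ->
    `|F t - F x| <= (`|l| + e) * `|t - x|.
Proof.
move=> [dF Fl] e0.
have : h^-1 *: ((F \o shift x) (h *: (1 : R)) - F x) @[h --> 0^'] --> l.
  by rewrite -Fl; exact: dF.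
move/cvgrPdist_lt => /(_ _ e0); rewrite near_withinE => -[r /= r0 H].
exists r => // t tx; have [->|tnx] := eqVneq t x.
  by rewrite !subrr normr0 mulr0.
have tx0 : t - x != 0 by rewrite subr_eq0.
have := H (t - x); rewrite /= sub0r normrN => /(_ tx tx0).
rewrite /shift/= scaler1 subrK => {}H.
have E : F t - F x = (t - x)^-1 *: (F t - F x) * (t - x).
  by rewrite /GRing.scale/= mulrAC mulVf// mul1r.
rewrite E normrM ler_wpM2r//.
rewrite -[X in `|X| <= _](subrK l) addrC (le_trans (ler_normD _ _))// lerD2l.
by rewrite distrC ltW.
Qed.

(* The layers E n of the values of G are covered by open sets U n of almost the same
   measure; near a point of E n, F grows at most like n.+2 * e times the measure
   restricted to U n, so the sum m of these measures dominates F locally. *)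
Lemma increment_le_integral (R : realType) (F F' G : R -> R) (a b : R) :
  a <= b ->
  (forall x, a <= x <= b -> is_derive x 1 F (F' x)) ->
  (forall x, a <= x <= b -> `|F' x| <= G x) ->
  measurable_fun `[a, b] G ->
  (`|F b - F a|%:E <= \int[mu]_(x in `[a, b]) (G x)%:E)%E.
Proof.
move=> ab dF F'G mG.
have G0 x : a <= x <= b -> 0 <= G x by move=> /F'G; exact: le_trans.
apply/lee_addgt0Pr => e0 e0_gt0.
(* Chosen so that 2 e (b - a) + e = e0: an error 2 e in height on every layer, and e in all for the
   excess of the open covers. *)
pose e := e0 / (2 * (b - a) + 1).
have den : 0 < 2 * (b - a) + 1 by lra.
have e_gt0 : 0 < e by rewrite divr_gt0.
pose E n := `[a, b] `&` G @^-1` `[n%:R * e, n.+1%:R * e[.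
have mE n : measurable (E n : set (measurableTypeR R)) by exact: mG.
have Efin n : (mu (E n) < +oo)%E.
  rewrite (@le_lt_trans _ _ (mu `[a, b]%classic))//.
    by apply: le_measure; rewrite ?inE//; exact: subIsetl.
  by rewrite lebesgue_measure_itv/=; case: ifPn => _; rewrite -?EFinB ?ltry.
(* Multiplied by the weight [n.+2%:R * e] of layer n, this excess is e / 2^(n + 1), and these sum to
   e. *)
have d_gt0 n : 0 < e / (2 ^ n.+1)%:R / (n.+2%:R * e).
  by rewrite !divr_gt0// ?ltr0n ?expn_gt0// mulr_gt0.
have /choice[U HU] n : exists U, [/\ open U, E n `<=` U &
    (mu (U `\` E n) < (e / (2 ^ n.+1)%:R / (n.+2%:R * e))%:E)%E].
  apply: (lebesgue_regularity_outer (mE n) (Efin n) (d_gt0 n)).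
have mU n : measurable (U n : set (measurableTypeR R)).
  by apply: open_measurable; case: (HU n).
have w_ge0 n : 0 <= n.+2%:R * e by rewrite mulr_ge0// ltW.
pose m := mseries (fun n => mscale (NngNum (w_ge0 n)) (mrestr mu (mU n))) 0.
have mEq A : m A = (\sum_(n <oo) (n.+2%:R * e)%:E * mu (A `&` U n))%E by [].
have m_ge n A : measurable A -> ((n.+2%:R * e)%:E * mu (A `&` U n) <= m A)%E.
  move=> mA; rewrite mEq.
  rewrite (@nneseriesD1 _ _ n)//; last by move=> k _; rewrite mule_ge0 ?lee_fin.
  by rewrite leeDl// nneseries_ge0// => k _ _; rewrite mule_ge0 ?lee_fin.
(* Serves both one-sided conditions: [A] will be the half-open interval between x and t. On layer n,
   |F' x| + e is at most (n + 2) e, the weight of [U n]. *)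
have loc x : a <= x <= b -> exists2 r, 0 < r & forall t, `|t - x| < r ->
    forall A : set R, measurable A -> A `<=` ball x r ->
    mu A = `|t - x|%:E -> (`|F t - F x|%:E <= m A)%E.
  move=> xab.
  have [r1 r1_gt0 H1] := is_derive_increment_le (dF x xab) e_gt0.
  pose n := Num.truncn (G x / e).
  have Gxe : 0 <= G x / e by rewrite divr_ge0 ?G0// ltW.
  have Enx : E n x.
    split => //=; rewrite in_itv/= -ler_pdivlMr// -ltr_pdivrMr//.
    exact: Num.Theory.truncn_itv.
  have [oU EU _] := HU n.
  have /nbhs_ballP[r2 /= r2_gt0 H2] : nbhs x (U n).
    by apply: open_nbhs_nbhs; split => //; exact: EU.
  exists (Num.min r1 r2); first by rewrite lt_min r1_gt0.
  move=> t; rewrite lt_min => /andP[tr1 tr2] A mA Ar muA.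
  rewrite (le_trans _ (m_ge n _ mA))//.
  have -> : A `&` U n = A.
    apply/setIidPl => y /Ar yr; apply: H2.
    by apply: le_ball yr; rewrite ge_min lexx orbT.
  rewrite muA -EFinM lee_fin (le_trans (H1 _ tr1))// ler_wpM2r//.
  rewrite -addn1 natrD mulrDl mul1r lerD2r (le_trans (F'G _ xab))//.
  by case: Enx => _ /=; rewrite in_itv/= => /andP[_ /ltW].
have itvmu (x y : R) : x < y -> mu `]x, y]%classic = (y - x)%:E.
  by move=> xy; rewrite lebesgue_measure_itv/= lte_fin xy.
apply: (@le_trans _ _ (m `]a, b]%classic)).
  apply: (@increment_le_measure_local _ m) => // x /loc[r r0 H]; exists r => //.
  - move=> t _ tr xt; apply: H => //.
      move=> y; rewrite /= in_itv/= /ball/= => /andP[xy yt].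
      rewrite distrC (le_lt_trans _ tr)// !gtr0_norm ?subr_gt0//.
        by rewrite lerD2r.
    by rewrite itvmu// gtr0_norm// subr_gt0.
  - move=> t _ tr tx; rewrite distrC; apply: H => //.
      move=> y; rewrite /= in_itv/= /ball/= => /andP[ty yx].
      rewrite (le_lt_trans _ tr)// ger0_norm ?subr_ge0// ltr0_norm ?subr_lt0//.
      by rewrite opprB lerD2l lerN2 ltW.
    by rewrite itvmu// ltr0_norm ?subr_lt0// opprB.
have tE : trivIset setT E.
  apply/trivIsetP => i j _ _; wlog ij : i j / (i < j)%N.
    move=> H; rewrite neq_ltn => /orP[ij|ji].
      by apply: H; rewrite ?ltn_eqF.
    by rewrite setIC; apply: H; rewrite ?ltn_eqF.
  move=> _; apply/seteqP; split => // x [[_ /=]].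
  rewrite in_itv/= => /andP[_ xi] [_ /=]; rewrite in_itv/= => /andP[jx _].
  have := le_lt_trans jx xi.
  by rewrite ltr_pM2r// ltr_nat ltnS leqNgt ij.
have UE : \bigcup_n E n = `[a, b]%classic.
  apply/seteqP; split => [x [n _ []//]|x xab].
  have xab' : a <= x <= b by [].
  have Gxe : 0 <= G x / e by rewrite divr_ge0 ?G0// ltW.
  exists (Num.truncn (G x / e)) => //; split => //=.
  rewrite in_itv/= -ler_pdivlMr// -ltr_pdivrMr//.
  exact: Num.Theory.truncn_itv.
have mGe : measurable_fun `[a, b] (fun x => G x + 2 * e).
  exact: measurable_funD.
apply: (@le_trans _ _ (\int[mu]_(x in `[a, b]) (G x + 2 * e)%:E + e%:E)%E).
  rewrite -UE ge0_integral_bigcup//=; last 2 first.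
  - by rewrite UE; exact/measurable_EFinP.
  - by rewrite UE => x xab; rewrite lee_fin addr_ge0// ?G0// mulr_ge0// ltW.
  apply: le_trans (epsilon_trick _ _ _); last 2 first.
  - move=> n; apply: integral_ge0 => x [xab _].
    by rewrite lee_fin addr_ge0// ?G0// mulr_ge0// ltW.
  - exact: ltW.
  rewrite mEq; apply: lee_nneseries => [n _ _|n _]; first by rewrite mule_ge0 ?lee_fin.
  have [oU EU muU] := HU n.
  (* Split [U n] into the layer, where the weight is at most G + 2 e, and the excess, whose weighted
     measure is at most e / 2^(n + 1). *)
  apply: (@le_trans _ _ ((n.+2%:R * e)%:E * (mu (E n) + mu (U n `\` E n)))%E).
    rewrite lee_wpmul2l// ?lee_fin// -measureU//; last 2 first.
    - exact: measurableD.
    - by rewrite setDE setICA setICr setI0.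
    - rewrite setDUK//; apply: le_measure; rewrite ?inE//.
      exact: measurableI.
  rewrite ge0_muleDr// leeD//.
    rewrite -integral_cst//; apply: ge0_le_integral => //.
    - by move=> x _; rewrite lee_fin.
    - apply/measurable_EFinP; apply: measurable_funS mGe => //.
      exact: subIsetl.
    - move=> x [_ /=]; rewrite in_itv/= => /andP[nx _]; rewrite lee_fin.
      by rewrite -addn2 natrD mulrDl lerD2r.
  apply: (@le_trans _ _ ((n.+2%:R * e)%:E * (e / (2 ^ n.+1)%:R / (n.+2%:R * e))%:E)%E).
    by rewrite lee_wpmul2l ?lee_fin// ltW.
  by rewrite -EFinM mulrC divfK// mulf_neq0// gt_eqF.
under eq_integral do rewrite EFinD.
have G0E x : `[a, b]%classic x -> (0 <= (G x)%:E)%E by move=> xab; rewrite lee_fin G0.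
have mGE : measurable_fun `[a, b] (EFin \o G) by exact/measurable_EFinP.
have e2 : (0 <= (2 * e)%:E)%E by rewrite lee_fin mulr_ge0// ltW.
rewrite ge0_integralD//.
have intc : (\int[mu]_(x in `[a, b]) (2 * e)%:E = (2 * e)%:E * mu `[a, b]%classic)%E.
  exact: integral_cst.
rewrite -addeA leeD2l// intc lebesgue_measure_itv/= lte_fin.
have e0E : e0 = 2 * e * (b - a) + e.
  by rewrite /e; field; rewrite gt_eqF.
case: ifPn => [_|_]; first by rewrite -EFinB -EFinM -EFinD lee_fin -e0E.
rewrite mule0 add0e lee_fin e0E lerDr mulr_ge0// ?subr_ge0// mulr_ge0// ltW//.
Qed.

(** * Lebesgue integrals on the real line *)

(** By uniqueness of Lebesgue measure it suffices to look at intervals []a, b]], and translation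
    preserves their length. *)
Lemma lebesgue_measure_translation (R : realType) (c : R) (A : set R) :
  measurable A ->
  pushforward mu ((fun x => x + c) : measurableTypeR R -> measurableTypeR R) A =
  mu A.
Proof.
have mc : measurable_fun setT
    ((fun x => x + c) : measurableTypeR R -> measurableTypeR R).
  exact: measurable_funD.
pose phi : {mfun measurableTypeR R >-> measurableTypeR R} :=
  HB.pack (fun x : R => x + c) (isMeasurableFun.Build _ _ _ _ _ mc).
move=> mA; apply/esym.
apply: (@lebesgue_measure_unique R (pushforward mu phi)) => //= _ [[a b]] _ <-.
rewrite /pushforward /=.
have -> : (fun x => x + c) @^-1` `]a, b] = `](a - c), (b - c)]%classic.
  by apply/seteqP; split=> x /=; rewrite !in_itv/= ltrBlDr lerBrDr.
rewrite !lebesgue_measure_itv/= !lte_fin ltrD2r.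
by case: ifPn => // _; rewrite -!EFinB; congr (_%:E); lra.
Qed.

Lemma Rintegral_translation (R : realType) (f : R -> R) (c : R) :
  mu.-integrable setT (EFin \o f) ->
  Rintegral mu setT (fun x => f (x + c)) = Rintegral mu setT f.
Proof.
move=> intf; congr fine.
have mc : measurable_fun setT
    ((fun x => x - c) : measurableTypeR R -> measurableTypeR R).
  exact: measurable_funD.
have mc' : measurable_fun setT
    ((fun x => x + c) : measurableTypeR R -> measurableTypeR R).
  exact: measurable_funD.
pose g x := (f (x + c))%:E.
have gf : g \o (fun x => x - c) = EFin \o f.
  by apply/funext => x; rewrite /g/= subrK.
have mg : measurable_fun setT g.
  apply/measurable_EFinP; apply: (measurableT_comp _ mc').
  by have /measurable_EFinP mf := measurable_int _ intf.
have intg : mu.-integrable ((fun x => x - c) @^-1` setT) (g \o (fun x => x - c)).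
  by rewrite gf preimage_setT.
have := @integral_pushforward _ _ _ _ R _ mc mu setT g mg intg measurableT.
rewrite gf preimage_setT => <-.
apply: eq_measure_integral => /= A mA _.
by rewrite lebesgue_measure_translation.
Qed.

Lemma integral_primitive (R : realType) (F g : R -> R) (a b : R) :
  a < b -> (forall x, a <= x <= b -> is_derive x 1 F (g x)) ->
  (forall x, a <= x <= b -> {for x, continuous g}) ->
  (\int[mu]_(x in `[a, b]) (g x)%:E = (F b - F a)%:E)%E.
Proof.
move=> ab dF cg; rewrite EFinB; apply: continuous_FTC2 => //.
- apply: continuous_in_subspaceT => x; rewrite inE/= in_itv/= => xab.
  exact: cg.
- have cF x : a <= x <= b -> {for x, continuous F}.
    move=> xab; apply: differentiable_continuous; apply/derivable1_diffP.
    by have [] := dF _ xab.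
  split.
  + by move=> x; rewrite in_itv/= => /andP[ax xb]; have [] := dF x; rewrite ?ltW.
  + by apply: cvg_at_right_filter; apply: cF; rewrite lexx ltW.
  + by apply: cvg_at_left_filter; apply: cF; rewrite lexx ltW.
- move=> x; rewrite in_itv/= => /andP[ax xb]; rewrite derive1E.
  by have [] := dF x; rewrite ?ltW.
Qed.

Lemma integral_primitivey (R : realType) (F g : R -> R) (a l : R) :
  (forall x, a <= x -> 0 <= g x) ->
  (forall x, a <= x -> is_derive x 1 F (g x)) ->
  (forall x, a <= x -> {for x, continuous g}) ->
  F x @[x --> +oo] --> l ->
  (\int[mu]_(x in `[a, +oo[) (g x)%:E = (l - F a)%:E)%E.
Proof.
move=> g0 dF cg Fl; rewrite EFinB; apply: ge0_continuous_FTC2y => //.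
- apply: continuous_in_subspaceT => x; rewrite inE/= in_itv/= andbT.
  exact: cg.
- by move=> x /ltW ax; have [] := dF _ ax.
- apply: cvg_at_right_filter; apply: differentiable_continuous.
  by apply/derivable1_diffP; have [] := dF a (lexx a).
- move=> x; rewrite in_itv/= andbT => /ltW ax; rewrite derive1E.
  by have [] := dF _ ax.
Qed.

Lemma powR_cvgy0 (R : realType) (s : R) : 0 < s -> x `^ (- s) @[x --> +oo] --> 0.
Proof.
move=> s0; apply: (@cvg_trans _ (expR (- (s * ln x)) @[x --> +oo])).
  apply: near_eq_cvg; near=> x.
  by rewrite /powR gt_eqF ?mulNr//; near: x; exact: nbhs_pinfty_gt.
apply: (@cvg_comp _ _ _ (fun x => s * ln x) (fun y => expR (- y)) _ (@pinfty_nbhs R)).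
  apply: gt0_cvgMry => //; apply/cvgryPge => A; near=> x.
  have Ax : expR A <= x by near: x; exact: nbhs_pinfty_ge.
  by rewrite -(expRK A) ler_ln ?posrE ?expR_gt0// (lt_le_trans _ Ax) ?expR_gt0.
exact: cvgr_expR.
Unshelve. all: by end_near. Qed.

Lemma continuous_powRl (R : realType) (s x : R) :
  0 < x -> {for x, continuous (@powR R ^~ s)}.
Proof.
move=> x0; apply: differentiable_continuous; apply/derivable1_diffP.
by have [] := is_derive1_powR s x0.
Qed.

Lemma integral_powR_tail (R : realType) (s b : R) : 0 < s -> 0 < b ->
  (\int[mu]_(z in `[b, +oo[) (z `^ (- s - 1))%:E = (b `^ (- s) / s)%:E)%E.
Proof.
move=> s0 b0.
pose F z := (- s^-1) *: (z `^ (- s)).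
have -> : b `^ (- s) / s = 0 - F b.
  by rewrite /F /GRing.scale/=; field; rewrite gt_eqF.
apply: integral_primitivey.
- by move=> x _; exact: powR_ge0.
- move=> x bx; have x0 := lt_le_trans b0 bx.
  have ? := is_derive1_powR (- s) x0.
  apply: is_derive_eq; rewrite /GRing.scale/=; field.
  by rewrite gt_eqF.
- by move=> x bx; apply: continuous_powRl; exact: lt_le_trans bx.
- rewrite -(mulr0 (- s^-1)); apply: cvgMr; exact: powR_cvgy0.
Qed.

(** * Phases *)

(* The real part of (p + i q) e^(i t). *)
Definition rephase {R : realType} (p q t : R) : R := p * cos t - q * sin t.

(** A rotation preserves the modulus: [rephase p q t] and [p * sin t + q * cos t] are the two
    coordinates of the rotated number, so their squares add up to p^2 + q^2. *)
Lemma rephase_le (R : realType) (p q t : R) :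
  `|rephase p q t| <= Num.sqrt (p ^+ 2 + q ^+ 2).
Proof.
rewrite -sqrtr_sqr ler_sqrt ?addr_ge0 ?sqr_ge0//.
have -> : p ^+ 2 + q ^+ 2 = rephase p q t ^+ 2 + (p * sin t + q * cos t) ^+ 2.
  have E := cos2Dsin2 t; rewrite /rephase -[LHS]mulr1 -E; ring.
by rewrite lerDl sqr_ge0.
Qed.

(** The imaginary part of a number is the real part of its product with - i, which turns the pair
    (p, q) into (q, - p). *)
Lemma rephase_sin_le (R : realType) (p q t : R) :
  `|p * sin t + q * cos t| <= Num.sqrt (p ^+ 2 + q ^+ 2).
Proof.
have := rephase_le q (- p) t.
by rewrite /rephase mulNr opprK sqrrN addrC [X in Num.sqrt X]addrC.
Qed.

Lemma is_derive_rephase (R : realType) (p q t : R) :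
  is_derive t 1 (rephase p q) (- (p * sin t + q * cos t)).
Proof.
rewrite /rephase; apply: is_derive_eq.
by rewrite /GRing.scale/=; ring.
Qed.

Lemma rephase_lip (R : realType) (p q s t : R) :
  `|rephase p q s - rephase p q t| <= Num.sqrt (p ^+ 2 + q ^+ 2) * `|s - t|.
Proof.
wlog ts : s t / t <= s.
  move=> H; have [/H//|/ltW/H] := leP t s.
  by rewrite distrC [X in _ * X]distrC.
have [||c _ ->] := @MVT_segment R (rephase p q)
    (fun x => - (p * sin x + q * cos x)) t s ts.
- by move=> x _; exact: is_derive_rephase.
- apply: derivable_within_continuous => x _.
  by have [] := is_derive_rephase p q x.
by rewrite normrM normrN ler_wpM2r// rephase_sin_le.
Qed.

Lemma rephase_le2 (R : realType) (p q s t : R) :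
  `|rephase p q s - rephase p q t| <= 2 * Num.sqrt (p ^+ 2 + q ^+ 2).
Proof.
by rewrite (le_trans (ler_normB _ _))// mulrDl mul1r lerD// rephase_le.
Qed.

(** Factoring e^y out of the logarithm puts the deviation from the identity in a form that is
    visibly nonnegative and tends to 0 as y goes to -oo. *)
Lemma xmapE (R : realType) (y : R) : y - xmap y = ln (1 + expR y).
Proof.
rewrite /xmap opprK -[X in X + _](expRK y) -lnM ?posrE ?addr_gt0 ?expR_gt0//.
by congr ln; rewrite mulrDr mulr1 -expRD subrr expR0 addrC.
Qed.

Lemma is_derive_xmap (R : realType) (y : R) :
  is_derive y 1 (@xmap R) (1 + expR y)^-1.
Proof.
have p0 : 0 < 1 + expR y by rewrite addr_gt0 ?expR_gt0.
have -> : @xmap R = (fun y => y - ln (1 + expR y)).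
  by apply/funext => z; rewrite -xmapE; lra.
have dln := is_derive1_ln p0.
have dg : is_derive y 1 (fun y : R => 1 + expR y) (expR y).
  by apply: is_derive_eq; rewrite add0r mul1r.
have dl := @is_derive1_comp R (@ln R) (fun y => 1 + expR y) y _ _ dln dg.
have := @is_deriveB _ _ _ id _ y 1 _ _ (is_derive_id y 1) dl.
by congr is_derive; field; rewrite gt_eqF.
Qed.

(** * Absolute bounds for integrals of rephased functions *)

Lemma normr_Rintegral_le (R : realType) (A : set R) (D g : R -> R) (E : R) :
  measurable A -> mu.-integrable A (EFin \o D) ->
  (forall x, A x -> `|D x| <= g x) -> measurable_fun A g ->
  (\int[mu]_(x in A) (g x)%:E <= E%:E)%E ->
  `|Rintegral mu A D| <= E.
Proof.
move=> mA iD Dg mg gE; rewrite -lee_fin EFin_normr_Rintegral//.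
have mD := measurable_int _ iD.
apply: le_trans (le_abse_integral mu mA mD) _.
apply: le_trans gE; have mg' : measurable_fun A (EFin \o g) by exact/measurable_EFinP.
by apply: ge0_le_integral => //; exact: measurableT_comp.
Qed.

Lemma Rintegral_setT_splitl (R : realType) (D : R -> R) (b : R) :
  mu.-integrable setT (EFin \o D) ->
  Rintegral mu setT D = Rintegral mu `]-oo, b] D + Rintegral mu `]b, +oo[ D.
Proof.
move=> iD; have e : setT = `]-oo, b]%classic `|` `]b, +oo[%classic.
  by rewrite -set_itvNyy (@itv_bndbnd_setU _ _ _ (BRight b)).
rewrite {1}e; apply: Rintegral_setU => //; first by rewrite -e.
apply/disj_setPRL => x /=; rewrite !in_itv/= andbT => bx.
by apply/negP; rewrite -ltNge.
Qed.

(** The pattern of the low-frequency estimates: left of [b] a small multiple of a nonnegative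
    weight, whose integral may be extended to the whole line, and right of [b] an explicit tail. *)
Lemma Rintegral_split_le (R : realType) (D N g : R -> R) (b c E : R) :
  mu.-integrable setT (EFin \o D) -> mu.-integrable setT (EFin \o N) ->
  0 <= c -> (forall z, 0 <= N z) ->
  (forall z, z <= b -> `|D z| <= c * N z) ->
  (forall z, b <= z -> `|D z| <= g z) -> measurable_fun `[b, +oo[ g ->
  (\int[mu]_(z in `[b, +oo[) (g z)%:E <= E%:E)%E ->
  `|Rintegral mu setT D| <= c * Rintegral mu setT N + E.
Proof.
move=> iD iN c0 N0 Dl Dr mg gE.
have /measurable_EFinP mN := measurable_int _ iN.
rewrite (Rintegral_setT_splitl b)// (le_trans (ler_normD _ _))// lerD//.
- apply: (@normr_Rintegral_le _ _ _ (fun z => c * N z)) => //.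
  + by apply: integrableS iD.
  + by apply: measurable_funTS; exact: measurable_funM.
  + rewrite -RintegralZl// /Rintegral fineK; last first.
      apply: integrable_fin_num => //.
      by apply: (integrableZl measurableT c) iN.
    apply: ge0_subset_integral => //.
    * by apply/measurable_EFinP; exact: measurable_funM.
    * by move=> x _; rewrite lee_fin mulr_ge0.
- have sub : `]b, +oo[ `<=` (`[b, +oo[%classic : set R).
    by apply: subset_itvr; rewrite bnd_simp.
  apply: (@normr_Rintegral_le _ _ _ g) => //.
  + by apply: integrableS iD.
  + by move=> x /=; rewrite in_itv/= andbT => /ltW; exact: Dr.
  + exact: measurable_funS mg.
  + apply: le_trans gE; apply: ge0_subset_integral => //.
    * exact/measurable_EFinP.
    * move=> x /=; rewrite in_itv/= andbT lee_fin => bx.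
      by rewrite (le_trans _ (Dr _ bx)).
Qed.

Local Notation cnorm p q := (Num.sqrt (p ^+ 2 + q ^+ 2)).

Lemma measurable_cnorm (R : realType) (p q : R -> R) :
  measurable_fun setT p -> measurable_fun setT q ->
  measurable_fun setT (fun z => cnorm (p z) (q z)).
Proof.
move=> mp mq.
apply: (measurableT_comp (continuous_measurable_fun (@sqrt_continuous R))).
by apply: measurable_funD; exact: measurable_funX.
Qed.

Lemma cnorm_le (R : realType) (p q : R) : cnorm p q <= `|p| + `|q|.
Proof.
rewrite -[leRHS]ger0_norm ?addr_ge0// -sqrtr_sqr ler_sqrt ?sqr_ge0//.
rewrite sqrrD !real_normK ?num_real// lerD2r lerDl.
by rewrite mulrn_wge0// mulr_ge0.
Qed.

Lemma integrable_cnorm (R : realType) (p q : R -> R) : cintegrable p q ->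
  mu.-integrable setT (EFin \o (fun z => cnorm (p z) (q z))).
Proof.
move=> [ip iq].
have /measurable_EFinP mp := measurable_int _ ip.
have /measurable_EFinP mq := measurable_int _ iq.
have ipq : mu.-integrable setT (EFin \o (fun z => `|p z| + `|q z|)).
  exact: (integrableD measurableT (integrable_norm ip) (integrable_norm iq)).
apply: le_integrable ipq => //.
- by apply/measurable_EFinP; exact: measurable_cnorm.
- move=> x _ /=; rewrite lee_fin ger0_norm ?sqrtr_ge0//.
  by rewrite ger0_norm ?addr_ge0// cnorm_le.
Qed.

Lemma measurable_rephase (R : realType) (p q t : R -> R) :
  measurable_fun setT p -> measurable_fun setT q -> measurable_fun setT t ->
  measurable_fun setT (fun z => rephase (p z) (q z) (t z)).
Proof.
move=> mp mq mt; apply: measurable_funB; apply: measurable_funM => //.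
  exact: (measurableT_comp (continuous_measurable_fun (@continuous_cos R))).
exact: (measurableT_comp (continuous_measurable_fun (@continuous_sin R))).
Qed.

Lemma integrable_rephase (R : realType) (p q t : R -> R) :
  cintegrable p q -> measurable_fun setT t ->
  mu.-integrable setT (EFin \o (fun z => rephase (p z) (q z) (t z))).
Proof.
move=> ipq mt; have [ip iq] := ipq.
have /measurable_EFinP mp := measurable_int _ ip.
have /measurable_EFinP mq := measurable_int _ iq.
apply: le_integrable (integrable_cnorm ipq) => //.
- by apply/measurable_EFinP; exact: measurable_rephase.
- by move=> x _ /=; rewrite lee_fin [leRHS]ger0_norm ?sqrtr_ge0// rephase_le.
Qed.

(** Dominated convergence, applied to the restrictions of [N] to half-lines receding to -oo. This
    disposes of the left end when integrating by parts on an unbounded interval. *)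
Lemma Rintegral_tail_small (R : realType) (N : R -> R) (Z e : R) :
  mu.-integrable setT (EFin \o N) -> (forall z, 0 <= N z) -> 0 < e ->
  exists2 a, a <= Z & Rintegral mu `]-oo, a] N < e.
Proof.
move=> iN N0 e0.
have /measurable_EFinP mN := measurable_int _ iN.
pose A n : set R := `]-oo, Z - n%:R]%classic.
pose f n := (EFin \o N) \_ (A n).
have mf n : measurable_fun setT (f n).
  have mA : measurable (A n) by exact: measurable_itv.
  apply: (measurable_restrictT (EFin \o N) mA).1.
  by apply: measurable_funTS; exact/measurable_EFinP.
have f0 : {ae mu, forall x, setT x -> f ^~ x @ \oo --> cst 0%E x}.
  apply: aeW => x _; apply: cvg_near_cst; near=> n.
  rewrite /f patchE memNset//= /A/= in_itv/=; apply/negP; rewrite -ltNge.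
  by rewrite ltrBlDr -ltrBlDl; near: n; exact: nbhs_infty_gtr.
have fN : {ae mu, forall x n, setT x -> (`|f n x| <= (EFin \o N) x)%E}.
  apply: aeW => x n _; rewrite /f patchE; case: ifPn => _ /=.
    by rewrite lee_fin ger0_norm.
  by rewrite normr0 lee_fin.
have [_ _ H] := @dominated_convergence _ (measurableTypeR R) R mu setT measurableT
  f (cst 0%E) (EFin \o N) mf (measurable_cst _) f0 iN fN.
rewrite integral0 in H.
have : \forall n \near \oo, (\int[mu]_(x in setT) f n x < e%:E)%E.
  move/fine_cvgP : H => [Hfin /cvgrPdist_lt /(_ _ e0) Hlt].
  near=> n.
  have fn : (\int[mu]_(x in setT) f n x \is a fin_num)%E by near: n.
  rewrite -(fineK fn) lte_fin.
  have : `|0 - fine (\int[mu]_(x in setT) f n x)| < e by near: n.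
  by rewrite sub0r normrN => /(le_lt_trans (ler_norm _)).
case=> n _ /(_ n (leqnn n)) /= Hn.
exists (Z - n%:R); first by rewrite gerBl.
have iNA : mu.-integrable (A n) (EFin \o N).
  by apply: integrableS iN => //; exact: measurable_itv.
rewrite -lte_fin /Rintegral fineK; last exact: integrable_fin_num.
by rewrite integral_mkcond.
Unshelve. all: by end_near. Qed.

Lemma measurable_powR_itv (R : realType) (c s : R) (A : set R) :
  measurable_fun A (fun z => c * z `^ s).
Proof.
by apply: measurable_funTS; apply: measurable_funM => //; exact: measurable_powR.
Qed.

Lemma integral_cst_powR_tail (R : realType) (c s b : R) :
  0 <= c -> 0 < s -> 0 < b ->
  (\int[mu]_(z in `[b, +oo[) (c * z `^ (- s - 1))%:E <= (c * b `^ (- s) / s)%:E)%E.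
Proof.
move=> c0 s0 b0; under eq_integral do rewrite EFinM.
rewrite ge0_integralZl//=; last 2 first.
- by apply/measurable_EFinP; apply: measurable_funTS; exact: measurable_powR.
- by move=> z _; rewrite lee_fin powR_ge0.
by rewrite integral_powR_tail// -EFinM mulrA.
Qed.

Lemma measurable_xmap (R : realType) : measurable_fun setT (@xmap R).
Proof.
apply: continuous_measurable_fun => y.
apply: differentiable_continuous; apply/derivable1_diffP.
by have [] := is_derive_xmap y.
Qed.

Lemma measurable_phase (R : realType) (k T : R) :
  measurable_fun setT (fun z : R => k * xmap (z - T)).
Proof.
apply: measurable_funM => //; apply: (measurableT_comp (@measurable_xmap R)).
exact: measurable_funB.
Qed.

Lemma xmap_dist_le (R : realType) (y : R) : `|xmap y - y| <= expR y.
Proof.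
rewrite distrC xmapE ger0_norm; last by rewrite ln_ge0// lerDl expR_ge0.
by apply: le_ln1Dx; rewrite (lt_le_trans _ (expR_ge0 y))// ltrN10.
Qed.

(** The claim amounts to 1 + e^(z - T) <= e^z, which holds because e^z >= 2 and e^(- T) <= 1/2. It
    replaces the exponential bound where z - T need not be negative. *)
Lemma xmap_dist_le_shift (R : realType) (z T : R) : 1 <= z -> 1 <= T ->
  `|xmap (z - T) - (z - T)| <= z.
Proof.
move=> z1 T1; rewrite distrC xmapE ger0_norm; last first.
  by rewrite ln_ge0// lerDl expR_ge0.
rewrite -[leRHS]expRK ler_ln ?posrE ?expR_gt0 ?addr_gt0 ?expR_gt0//.
rewrite expRD.
have e2 : 2 <= expR z by apply: le_trans (expR_ge1Dx z); lra.
have e2' : expR (- T) <= 2^-1.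
  rewrite expRN lef_pV2 ?posrE ?expR_gt0//.
  by apply: le_trans (expR_ge1Dx T); lra.
have : expR z * expR (- T) <= expR z * 2^-1 by rewrite ler_wpM2l// expR_ge0.
lra.
Qed.

(** * Pointwise bounds on the transform *)

(** Subtracting a vanishing Fourier integral leaves a difference of two phases. For z <= b these
    differ by at most k e^(b - T); the bound [g] beyond [b] is left open, since two frequency ranges
    call for two choices. *)
Lemma rephase_integral_le (R : realType) (p q : R -> R) (k T b E : R) (g : R -> R) :
  cintegrable p q -> 0 < k ->
  Rintegral mu setT (fun z => rephase (p z) (q z) (k * z)) = 0 ->
  Rintegral mu setT (fun z => rephase (q z) (- p z) (k * z)) = 0 ->
  (forall z, b <= z ->
    `|rephase (p z) (q z) (k * xmap (z - T)) - rephase (p z) (q z) (k * (z - T))|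
      <= g z) ->
  measurable_fun `[b, +oo[ g ->
  (\int[mu]_(z in `[b, +oo[) (g z)%:E <= E%:E)%E ->
  `|Rintegral mu setT (fun z => rephase (p z) (q z) (k * xmap (z - T)))| <=
    k * expR (b - T) * Rintegral mu setT (fun z => cnorm (p z) (q z)) + E.
Proof.
move=> ipq k0 H1 H2 Hg mg gE.
have [ip iq] := ipq.
have iqp : cintegrable q (fun z => - p z).
  by split => //; exact: (integrableN ip).
have mk : measurable_fun setT (fun z : R => k * z) by exact: measurable_funM.
have i1 := integrable_rephase ipq (measurable_phase k T).
have i2 := integrable_rephase ipq mk.
have i3 := integrable_rephase iqp mk.
have mkT : measurable_fun setT (fun z : R => k * (z - T)).
  by apply: measurable_funM => //; exact: measurable_funB.
have i4 := integrable_rephase ipq mkT.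
(* Shifting the phase by k T multiplies the Fourier integral by e^(- i k T), which mixes real and
   imaginary parts; hence both vanishing hypotheses enter. *)
have I0 : Rintegral mu setT (fun z => rephase (p z) (q z) (k * (z - T))) = 0.
  transitivity (Rintegral mu setT (fun z =>
      cos (k * T) * rephase (p z) (q z) (k * z) -
      (- sin (k * T)) * rephase (q z) (- p z) (k * z))).
    apply: eq_Rintegral => z _; rewrite /rephase mulrBr cosB sinB; ring.
  rewrite RintegralB//=; last 2 first.
  - exact: (integrableZl measurableT (cos (k * T)) i2).
  - exact: (integrableZl measurableT (- sin (k * T)) i3).
  by rewrite !RintegralZl// H1 H2 !mulr0 subr0.
rewrite -[X in `|X|]subr0 -[X in _ - X]I0 -RintegralB//.
apply: (@Rintegral_split_le _ _ (fun z => cnorm (p z) (q z)) g b) => //.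
- by have := integrableB measurableT i1 i4.
- exact: integrable_cnorm.
- by rewrite mulr_ge0 ?expR_ge0// ltW.
- move=> z zb; rewrite (le_trans (rephase_lip _ _ _ _))// mulrC.
  rewrite ler_wpM2r ?sqrtr_ge0// -mulrBr normrM gtr0_norm// ler_wpM2l ?(ltW k0)//.
  by rewrite (le_trans (xmap_dist_le _))// ler_expR lerD2r.
Qed.

(** Beyond [b] the difference of phases is bounded by twice the modulus. The resulting term does not
    shrink with k, so this estimate is for k >= 1. *)
Lemma rephase_integral_low (R : realType) (p q : R -> R) (k T b C alpha : R) :
  cintegrable p q -> 0 < k -> 0 < b -> 0 <= C -> 0 < alpha ->
  Rintegral mu setT (fun z => rephase (p z) (q z) (k * z)) = 0 ->
  Rintegral mu setT (fun z => rephase (q z) (- p z) (k * z)) = 0 ->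
  (forall z, b <= z -> cnorm (p z) (q z) <= C * z `^ (- alpha - 1)) ->
  `|Rintegral mu setT (fun z => rephase (p z) (q z) (k * xmap (z - T)))| <=
    k * expR (b - T) * Rintegral mu setT (fun z => cnorm (p z) (q z)) +
    2 * C * b `^ (- alpha) / alpha.
Proof.
move=> ipq k0 b0 C0 a0 H1 H2 dec.
apply: (@rephase_integral_le _ _ _ _ _ _ _
  (fun z => 2 * C * z `^ (- alpha - 1))) => //.
- move=> z bz; rewrite (le_trans (rephase_le2 _ _ _ _))// -mulrA.
  by rewrite ler_wpM2l// dec.
- exact: measurable_powR_itv.
- by apply: integral_cst_powR_tail => //; rewrite mulr_ge0.
Qed.

(** Beyond [b] the difference is at most 2 |f| (k z)^(1/4): by the Lipschitz bound if k z <= 1,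
    trivially otherwise. The factor z^(1/4) costs a quarter of the decay exponent; k^(1/4), once
    squared, is integrable against dk / k at 0. *)
Lemma rephase_integral_verylow (R : realType) (p q : R -> R) (k T b C alpha : R) :
  cintegrable p q -> 0 < k -> 1 <= b -> 1 <= T -> 0 <= C -> 4^-1 < alpha ->
  Rintegral mu setT (fun z => rephase (p z) (q z) (k * z)) = 0 ->
  Rintegral mu setT (fun z => rephase (q z) (- p z) (k * z)) = 0 ->
  (forall z, b <= z -> cnorm (p z) (q z) <= C * z `^ (- alpha - 1)) ->
  `|Rintegral mu setT (fun z => rephase (p z) (q z) (k * xmap (z - T)))| <=
    k * expR (b - T) * Rintegral mu setT (fun z => cnorm (p z) (q z)) +
    2 * C * k `^ 4^-1 * b `^ (- (alpha - 4^-1)) / (alpha - 4^-1).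
Proof.
move=> ipq k0 b1 T1 C0 a0 H1 H2 dec.
have b0 : 0 < b by exact: lt_le_trans b1.
apply: (@rephase_integral_le _ _ _ _ _ _ _
  (fun z => 2 * C * k `^ 4^-1 * z `^ (- (alpha - 4^-1) - 1))) => //.
- move=> z bz; have z0 := lt_le_trans b0 bz.
  set N := cnorm (p z) (q z).
  have N0 : 0 <= N by rewrite sqrtr_ge0.
  apply: (@le_trans _ _ (2 * N * (k * z) `^ 4^-1)).
    have kz0 : 0 < k * z by rewrite mulr_gt0.
    have [kz1|/ltW kz1] := leP (k * z) 1; last first.
      rewrite (le_trans (rephase_le2 _ _ _ _))// ler_peMr ?mulr_ge0//.
      have e : 1 `^ 4^-1 = 1 :> R by rewrite powR1.
      by rewrite -[leLHS]e ge0_ler_powR ?nnegrE ?invr_ge0// ltW.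
    rewrite (le_trans (rephase_lip _ _ _ _))// -/N mulrAC.
    apply: (@le_trans _ _ (N * (k * z))).
      rewrite ler_wpM2l// -mulrBr normrM gtr0_norm// ler_wpM2l ?(ltW k0)//.
      by apply: xmap_dist_le_shift => //; exact: le_trans bz.
    have h : k * z <= (k * z) `^ 4^-1.
      by apply: ger1_powR; [rewrite kz0|rewrite invf_le1 ?ler1n].
    have := ler_wpM2l N0 h.
    have : 0 <= N * (k * z) `^ 4^-1 by rewrite mulr_ge0 ?powR_ge0.
    by rewrite -!mulrA [_ * N]mulrC; lra.
  rewrite powRM ?(ltW k0) ?(ltW z0)//.
  have -> : - (alpha - 4^-1) - 1 = (- alpha - 1) + 4^-1 by ring.
  rewrite powRD; last by rewrite (gt_eqF z0) implybT.
  have := ler_wpM2r (mulr_ge0 (powR_ge0 k 4^-1) (powR_ge0 z 4^-1)) (dec z bz).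
  rewrite -/N; lra.
- exact: measurable_powR_itv.
- apply: integral_cst_powR_tail => //; last by rewrite subr_gt0.
  by rewrite !mulr_ge0 ?powR_ge0.
Qed.

Lemma increment_le_Rintegral (R : realType) (F F' G : R -> R) (a b c : R) :
  a <= b -> (forall x : R, is_derive x 1 F (F' x)) ->
  0 <= c -> (forall x, 0 <= G x) -> mu.-integrable setT (EFin \o G) ->
  (forall x, a <= x <= b -> `|F' x| <= c * G x) ->
  `|F b - F a| <= c * Rintegral mu setT G.
Proof.
move=> ab dF c0 G0 iG F'G.
have /measurable_EFinP mG := measurable_int _ iG.
have mcG : measurable_fun setT (fun x => c * G x) by exact: measurable_funM.
have mcG' : measurable_fun `[a, b] (fun x => c * G x) by exact: measurable_funTS.
rewrite -lee_fin (le_trans (increment_le_integral ab (fun x _ => dF x) F'G mcG'))//.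
rewrite -RintegralZl// /Rintegral fineK; last first.
  apply: integrable_fin_num => //.
  by apply: (integrableZl measurableT c) iG.
apply: ge0_subset_integral => //; first exact/measurable_EFinP.
by move=> x _; rewrite lee_fin mulr_ge0.
Qed.

(* Integration by parts: P is the primitive of the integrand, k / w the derivative of
   the phase th, and sg the imaginary part of f e^(i th).  In the derivative of
   Phi = P - sg w / k the integrand cancels, leaving terms in f' w and f w'. *)
Lemma rephase_primitive_le (R : realType) (p q p' q' : R -> R) (k T Z C : R) :
  (forall y : R, is_derive y 1 p (p' y)) -> (forall y : R, is_derive y 1 q (q' y)) ->
  cintegrable p q -> cintegrable p' q' -> 0 < k ->
  cnorm (p Z) (q Z) <= C ->
  `|Rintegral mu `]-oo, Z] (fun z => rephase (p z) (q z) (k * xmap (z - T)))| <=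
    2 * ((1 + expR (Z - T)) / k) *
    (C + Rintegral mu setT (fun z : R => cnorm (p z) (q z)) +
     Rintegral mu setT (fun z : R => cnorm (p' z) (q' z))).
Proof.
move=> dp dq ipq ip'q' k0 NZ.
set A1 := Rintegral mu setT (fun z : R => cnorm (p z) (q z)).
set A2 := Rintegral mu setT (fun z : R => cnorm (p' z) (q' z)).
have A1_ge0 : 0 <= A1 by apply: Rintegral_ge0 => x _; exact: sqrtr_ge0.
have A2_ge0 : 0 <= A2 by apply: Rintegral_ge0 => x _; exact: sqrtr_ge0.
have C0 : 0 <= C by exact: le_trans (sqrtr_ge0 _) NZ.
pose w (z : R) := 1 + expR (z - T).
have w0 z : 0 < w z by rewrite addr_gt0 ?expR_gt0.
pose th (z : R) := k * xmap (z - T).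
have dw (z : R) : is_derive z 1 w (expR (z - T)).
  by apply: is_derive_eq; rewrite /GRing.scale/=; ring.
have dth (z : R) : is_derive z 1 th (k / w z).
  have dx := is_derive_xmap (z - T).
  have ds : is_derive z 1 (fun z : R => z - T) 1 by apply: is_derive_eq; rewrite subr0.
  have dc := @is_derive1_comp R (@xmap R) (fun z : R => z - T) z _ _ dx ds.
  have := @is_deriveZ _ _ _ _ k z 1 _ dc.
  by congr is_derive; rewrite mulr1.
have dsin (z : R) : is_derive z 1 (@sin R \o th) (cos (th z) * (k / w z)).
  exact: is_derive1_comp.
have dcos (z : R) : is_derive z 1 (@cos R \o th) (- sin (th z) * (k / w z)).
  exact: is_derive1_comp.
pose u z := rephase (p z) (q z) (th z).
have iu : mu.-integrable setT (EFin \o u).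
  exact: integrable_rephase ipq (measurable_phase k T).
pose P x := Rintegral mu `]-oo, x] u.
have cont_of (f f' : R -> R) : (forall x : R, is_derive x 1 f (f' x)) -> continuous f.
  move=> df x; apply: differentiable_continuous; apply/derivable1_diffP.
  by have [] := df x.
have cu : continuous u.
  move=> x; apply: cvgB; apply: cvgM.
  - exact: cont_of dp x.
  - exact: cont_of dcos x.
  - exact: cont_of dq x.
  - exact: cont_of dsin x.
have dP (z : R) : is_derive z 1 P (u z).
  (* The half-line ends at z + 1 so that z is an interior point for the fundamental theorem. *)
  have iuz : mu.-integrable `]-oo, z + 1] (EFin \o u) by apply: integrableS iu.
  have zz : z < z + 1 by rewrite ltrDl.
  have [d e] := continuous_FTC1 zz iuz (ltNyr z) (cu z).
  split; [exact: d|rewrite -derive1E; exact: e].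
pose sg := (p * (@sin R \o th) + q * (@cos R \o th)) : R -> R.
have sgE z : sg z = p z * sin (th z) + q z * cos (th z) by [].
pose sg' z := p' z * sin (th z) + q' z * cos (th z).
have dsg (z : R) : is_derive z 1 sg (sg' z + u z * (k / w z)).
  have := is_deriveD (is_deriveM (dp z) (dsin z)) (is_deriveM (dq z) (dcos z)).
  by congr is_derive; rewrite /sg' /u /rephase /GRing.scale/=; ring.
pose Phi := (P - k^-1 *: (sg * w)) : R -> R.
have PhiE z : Phi z = P z - sg z * w z / k.
  by rewrite mulrC.
pose Phi' z := - ((sg' z * w z + sg z * expR (z - T)) / k).
have dPhi (z : R) : is_derive z 1 Phi (Phi' z).
  have ? := dsg z; have ? := dw z; have ? := dP z.
  apply: is_derive_eq; rewrite /Phi' /GRing.scale/=; field.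
  by rewrite !gt_eqF.
(* As [w] increases, this is the largest value of w / k left of [Z]; it also dominates w' / k
   there. *)
pose c := w Z / k.
have c0 : 0 <= c by rewrite divr_ge0 ?ltW.
have wc z : z <= Z -> w z / k <= c.
  by move=> zZ; rewrite ler_pM2r ?invr_gt0// lerD2l ler_expR lerD2r.
have wc' z : z <= Z -> expR (z - T) / k <= c.
  move=> zZ; rewrite (le_trans _ (wc z zZ))// ler_pM2r ?invr_gt0//.
  by rewrite /w lerDr.
have iN := integrable_cnorm ipq.
have iN' := integrable_cnorm ip'q'.
have bound a : a <= Z -> `|P Z| <= `|P a| + 2 * c * (C + A1 + A2).
  move=> aZ.
  have H1 : `|Phi Z - Phi a| <= c * (A2 + A1).
    rewrite /A1 /A2 -RintegralD//.
    apply: (increment_le_Rintegral aZ dPhi) => //.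
      exact: (integrableD measurableT iN' iN).
    move=> z /andP[_ zZ]; rewrite /Phi' normrN mulrDl (le_trans (ler_normD _ _))//.
    rewrite [leRHS]mulrDr /= lerD// -mulrA normrM mulrC.
    - rewrite ler_pM ?rephase_sin_le//.
      by rewrite ger0_norm ?wc// divr_ge0 ?ltW.
    - rewrite ler_pM ?rephase_sin_le//.
      by rewrite ger0_norm ?wc'// divr_ge0 ?expR_ge0// ltW.
  have H2 : `|sg Z * w Z / k| <= c * C.
    rewrite -mulrA normrM mulrC ler_pM//; last first.
      exact: le_trans (rephase_sin_le _ _ _) NZ.
    by rewrite ger0_norm.
  (* The decay says nothing at [a], far to the left. With the phase frozen at its value at [a], only
     f' contributes to the increment up to [Z], where the modulus is at most C. *)
  have H3 : `|sg a| <= C + A2.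
    pose F := (sin (th a) *: p + cos (th a) *: q) : R -> R.
    have dF (z : R) : is_derive z 1 F (sin (th a) * p' z + cos (th a) * q' z).
      exact: (is_deriveD (is_deriveZ (sin (th a)) (dp z))
                         (is_deriveZ (cos (th a)) (dq z))).
    have FE z : F z = p z * sin (th a) + q z * cos (th a).
      by rewrite [p z * _]mulrC [q z * _]mulrC.
    have FZ : `|F Z| <= C.
      by rewrite FE (le_trans (rephase_sin_le _ _ _)).
    have : `|F Z - F a| <= 1 * A2.
      apply: (increment_le_Rintegral aZ dF) => //.
      move=> x _; rewrite mul1r [_ * p' x]mulrC [_ * q' x]mulrC.
      exact: rephase_sin_le.
    rewrite mul1r sgE -FE => FA.
    have -> : F a = F Z - (F Z - F a) by ring.
    by rewrite (le_trans (ler_normB _ _))// lerD.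
  have H4 : `|sg a * w a / k| <= c * (C + A2).
    rewrite -mulrA normrM mulrC ler_pM// ger0_norm ?wc//.
    by rewrite divr_ge0 ?ltW.
  have -> : P Z = P a + (Phi Z - Phi a) + sg Z * w Z / k - sg a * w a / k.
    by rewrite !PhiE; ring.
  rewrite (le_trans (ler_normB _ _))//.
  have := ler_normD (P a + (Phi Z - Phi a)) (sg Z * w Z / k).
  have := ler_normD (P a) (Phi Z - Phi a).
  (* The boundary terms and the increment of [Phi] add up to c (2 C + A1 + 2 A2); one more c A1
     completes the factor 2. *)
  have : 0 <= c * A1 by rewrite mulr_ge0.
  lra.
(* Now [a] goes to -oo: |P a| is at most the integral of the modulus up to [a], hence below any e >
   0, while the rest of the bound does not depend on [a]. *)
apply/ler_addgt0Pr => e e0.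
have [a aZ Pa] := Rintegral_tail_small Z iN (fun z => sqrtr_ge0 _) e0.
rewrite (le_trans (bound a aZ))// addrC lerD2l.
apply: le_trans (ltW Pa).
have iua : mu.-integrable `]-oo, a] (EFin \o u) by apply: integrableS iu.
have iNa : mu.-integrable `]-oo, a] (EFin \o (fun z : R => cnorm (p z) (q z))).
  by apply: integrableS iN.
apply: (le_trans (le_normr_Rintegral _ iua)) => //.
apply: le_Rintegral => //; first by have := integrable_norm iua.
by move=> x _; exact: rephase_le.
Qed.

(** Integration by parts left of [Z], absolute decay right of it. The decay at [Z] itself, with Z >=
    1, bounds the boundary value by C. *)
Lemma rephase_integral_high (R : realType) (p q p' q' : R -> R)
    (k T Z C alpha : R) :
  (forall y : R, is_derive y 1 p (p' y)) -> (forall y : R, is_derive y 1 q (q' y)) ->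
  cintegrable p q -> cintegrable p' q' ->
  0 < k -> 1 <= Z -> 0 <= C -> 0 < alpha ->
  (forall z, Z <= z -> cnorm (p z) (q z) <= C * z `^ (- alpha - 1)) ->
  `|Rintegral mu setT (fun z => rephase (p z) (q z) (k * xmap (z - T)))| <=
    2 * ((1 + expR (Z - T)) / k) *
      (C + Rintegral mu setT (fun z : R => cnorm (p z) (q z)) +
       Rintegral mu setT (fun z : R => cnorm (p' z) (q' z)))
    + C * Z `^ (- alpha) / alpha.
Proof.
move=> dp dq ipq ip'q' k0 Z1 C0 a0 dec.
have Z0 : 0 < Z by exact: lt_le_trans Z1.
have iu := integrable_rephase ipq (measurable_phase k T).
rewrite (Rintegral_setT_splitl Z)// (le_trans (ler_normD _ _))// lerD//.
  apply: rephase_primitive_le => //.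
  apply: (le_trans (dec Z (lexx Z))).
  rewrite ler_piMr// -[X in X - 1]opprK -opprD powRN invf_le1 ?powR_gt0//.
  by rewrite -[leLHS](powRr0 Z) ler_powR// opprK addr_ge0// ltW.
have sub : `]Z, +oo[ `<=` (`[Z, +oo[%classic : set R).
  by apply: subset_itvr; rewrite bnd_simp.
apply: (@normr_Rintegral_le _ _ _ (fun z => C * z `^ (- alpha - 1))) => //.
- by apply: integrableS iu.
- move=> x /=; rewrite in_itv/= andbT => /ltW Zx.
  by rewrite (le_trans (rephase_le _ _ _))// dec.
- exact: measurable_powR_itv.
- apply: le_trans (integral_cst_powR_tail C0 a0 Z0).
  apply: ge0_subset_integral => //.
  + by apply/measurable_EFinP; exact: measurable_powR_itv.
  + by move=> x _; rewrite lee_fin mulr_ge0 ?powR_ge0.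
Qed.

(** * Integration over k *)

(** The integrand may be singular at 0, so the integral is reached as the limit of those over
    [1 / (n + 1), 1], each computed by a primitive. *)
Lemma integral_01_le (R : realType) (c d : R) : 0 <= c -> 0 <= d ->
  (\int[mu]_(k in `]0%R, 1%R]) (c * k + d * k `^ (- 2^-1))%:E <=
   (c / 2 + 2 * d)%:E)%E.
Proof.
move=> c0 d0.
pose g (k : R) := c * k + d * k `^ (- 2^-1).
pose A n : set R := `[n.+1%:R^-1, 1]%classic.
have bigA : `]0, 1]%classic = \bigcup_n A n.
  apply/seteqP; split => x /=.
    rewrite in_itv/= => /andP[x0 x1]; exists (Num.truncn x^-1) => //.
    rewrite /A/= in_itv/= x1 andbT invf_ple ?posrE//.
    by rewrite ltW// Num.Theory.truncnS_gt.
  move=> [n _]; rewrite /A/= !in_itv/= => /andP[nx ->]; rewrite andbT.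
  by rewrite (lt_le_trans _ nx)// invr_gt0.
have mg (B : set R) : measurable_fun B (EFin \o g).
  apply/measurable_EFinP; apply: measurable_funTS; apply: measurable_funD.
    exact: measurable_funM.
  by apply: measurable_funM => //; exact: measurable_powR.
have g0 k : 0 <= k -> 0 <= g k.
  by move=> k0; rewrite addr_ge0 ?mulr_ge0 ?powR_ge0.
have cvgA : (fun n => (\int[mu]_(k in A n) (g k)%:E)%E) @ \oo -->
    (\int[mu]_(k in \bigcup_n A n) (g k)%:E)%E.
  apply: ge0_nondecreasing_set_cvg_integral => //.
  - apply/nondecreasing_seqP => n; apply/subsetPset => x.
    rewrite /A/= !in_itv/= => /andP[nx ->]; rewrite andbT (le_trans _ nx)//.
    by rewrite lef_pV2 ?posrE// ler_nat.
  - by move=> n; exact: measurable_itv.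
  - by move=> n; exact: mg.
  - move=> n x; rewrite /A/= in_itv/= => /andP[nx _]; rewrite lee_fin g0//.
    by rewrite (le_trans _ nx).
rewrite bigA -(cvg_lim _ cvgA)//; apply: lime_le.
  by apply/cvg_ex; eexists; exact: cvgA.
(* For n = 0 the interval is the single point 1, while the primitive formula requires distinct
   endpoints. *)
apply: nearW => n; have [->|n0] := eqVneq n 0%N.
  have -> : A 0%N = [set 1] by rewrite /A invr1 set_itv1.
  by rewrite integral_set1 lee_fin addr_ge0 ?mulr_ge0.
pose F k := c / 2 * k ^+ 2 + 2 * d * k `^ (2^-1).
rewrite (_ : (\int[mu]_(k in A n) (g k)%:E = (F 1 - F n.+1%:R^-1)%:E)%E).
  have -> : F 1 = c / 2 + 2 * d by rewrite /F expr1n powR1 !mulr1.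
  by rewrite lee_fin gerBl addr_ge0 ?mulr_ge0 ?powR_ge0 ?invr_ge0.
apply: integral_primitive.
- by rewrite invf_lt1// ltr1n ltnS lt0n.
- move=> x /andP[nx _]; have x0 : 0 < x by rewrite (lt_le_trans _ nx).
  have ? := is_derive1_powR 2^-1 x0.
  apply: is_derive_eq; rewrite /g /GRing.scale/= (_ : 2^-1 - 1 = - 2^-1) ?expr1.
    by field.
  by field.
- move=> x /andP[nx _]; have x0 : 0 < x by rewrite (lt_le_trans _ nx).
  apply: cvgD; first by apply: cvgMr; exact: cvg_id.
  by apply: cvgMr; exact: continuous_powRl.
Qed.

Lemma integral_1k_le (R : realType) (c d k0 : R) : 1 < k0 ->
  (\int[mu]_(k in `[1%R, k0]) (c * k + d / k)%:E =
   (c * (k0 ^+ 2 - 1) / 2 + d * ln k0)%:E)%E.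
Proof.
move=> k01; pose F k := c / 2 * k ^+ 2 + d * ln k.
have -> : c * (k0 ^+ 2 - 1) / 2 + d * ln k0 = F k0 - F 1.
  by rewrite /F expr1n ln1; field.
apply: integral_primitive => [//|x /andP[x1 _]|x /andP[x1 _]].
- have x0 : 0 < x by exact: lt_le_trans x1.
  have ? := is_derive1_ln x0.
  by apply: is_derive_eq; rewrite /GRing.scale/=; field; rewrite gt_eqF.
- have x0 : x != 0 by rewrite gt_eqF// (lt_le_trans _ x1).
  apply: cvgD; first by apply: cvgMr; exact: cvg_id.
  by apply: cvgMr; apply: cvgV => //; exact: cvg_id.
Qed.

Lemma continuous_ky_integrand (R : realType) (c d h s x : R) :
  0 < x -> 0 < h + ln x / 2 ->
  {for x, continuous (fun k : R => c * k ^- 2 + d * ((h + ln k / 2) `^ s / k))}.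
Proof.
move=> x0 Zx; have xn0 : x != 0 by rewrite gt_eqF.
apply: cvgD; apply: cvgMr.
  by apply: cvgV; [rewrite expf_neq0|exact: exprn_continuous].
apply: cvgM; last by apply: cvgV => //; exact: cvg_id.
apply: (@continuous_comp _ _ _ (fun k : R => h + ln k / 2) (fun y => y `^ s)).
  apply: cvgD; first exact: cvg_cst.
  by apply: cvgMl; exact: continuous_ln.
exact: continuous_powRl.
Qed.

(** The substitution Z = h + (ln k) / 2 turns dk / k into 2 dZ: this is the source of the factor 2
    and of the convergence for s > 0. *)
Lemma integral_ky_eq (R : realType) (c d h s k0 : R) :
  0 <= c -> 0 <= d -> 0 < s -> 0 < k0 -> 0 < h + ln k0 / 2 ->
  (\int[mu]_(k in `[k0, +oo[)
     (c * k ^- 2 + d * ((h + ln k / 2) `^ (- s - 1) / k))%:E =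
   (c / k0 + 2 * d / s * (h + ln k0 / 2) `^ (- s))%:E)%E.
Proof.
move=> c0 d0 s0 k0_gt0 h0.
have pos x : k0 <= x -> 0 < x /\ 0 < h + ln x / 2.
  move=> kx; have x0 := lt_le_trans k0_gt0 kx; split => //.
  by rewrite (lt_le_trans h0)// lerD2l ler_pM2r ?invr_gt0// ler_ln.
pose Z (x : R) := h + ln x / 2.
have dZ (x : R) : 0 < x -> is_derive x 1 Z (x^-1 / 2).
  move=> x0; have ? := is_derive1_ln x0.
  by apply: is_derive_eq; rewrite /GRing.scale/=; field; rewrite gt_eqF.
pose F (x : R) := - (c * x^-1 + 2 * d / s * Z x `^ (- s)).
have -> : c / k0 + 2 * d / s * (h + ln k0 / 2) `^ (- s) = 0 - F k0.
  by rewrite /F sub0r opprK.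
apply: integral_primitivey.
- move=> x /pos[x0 _]; rewrite addr_ge0 ?mulr_ge0 ?powR_ge0 ?invr_ge0//.
    by rewrite exprn_ge0// ltW.
  exact: ltW.
- move=> x /pos[x0 Zx].
  have dx := dZ x x0; have dp := is_derive1_powR (- s) Zx.
  have dc := @is_derive1_comp R (fun y => y `^ (- s)) Z x _ _ dp dx.
  have xn0 : x != 0 by rewrite gt_eqF.
  have dv : is_derive x 1 (fun x => x^-1 : R) (- x ^- 2).
    have := @is_deriveV R id x 1 1 xn0 (is_derive_id x 1).
    by congr is_derive; rewrite /GRing.scale/= mulr1.
  have := is_deriveN (is_deriveD (is_deriveZ c dv) (is_deriveZ (2 * d / s) dc)).
  congr is_derive; rewrite /GRing.scale/= /Z; field.
  by rewrite !gt_eqF.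
- by move=> x /pos[x0 Zx]; exact: continuous_ky_integrand.
- rewrite /F -oppr0; apply: cvgN.
  rewrite (_ : 0 = c * 0 + 2 * d / s * 0); last by rewrite !mulr0 addr0.
  apply: cvgD; apply: cvgMr.
    apply: (@cvg_trans _ (x `^ (- 1) @[x --> +oo])); last exact: (powR_cvgy0 ltr01).
    apply: near_eq_cvg; near=> x.
    have x0 : 0 < x by near: x; exact: nbhs_pinfty_gt.
    by rewrite powR_inv1// ltW.
  apply: (@cvg_comp _ _ _ Z (fun y => y `^ (- s)) _ (@pinfty_nbhs R)).
    apply/cvgryPge => B; near=> x.
    have Bx : expR (2 * (B - h)) <= x by near: x; exact: nbhs_pinfty_ge.
    rewrite /Z -lerBlDl ler_pdivlMr// mulrC -(expRK (2 * (B - h))).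
    by rewrite ler_ln ?posrE ?expR_gt0// (lt_le_trans _ Bx) ?expR_gt0.
  exact: powR_cvgy0.
Unshelve. all: by end_near. Qed.

(** * The k-integral of the squared transform *)

(** The modulus dominates the integrand for every k. Continuity in k provides the measurability of
    the integrand of [half_inv_int]. *)
Lemma continuous_rephase_integral (R : realType) (p q X : R -> R) :
  cintegrable p q -> measurable_fun setT X ->
  continuous (fun k : R => Rintegral mu setT (fun z => rephase (p z) (q z) (k * X z))).
Proof.
move=> ipq mX k.
apply: (@continuity_under_integral R _ _ mu
   (fun k z => rephase (p z) (q z) (k * X z)) setT measurableT
   (k - 1) (k + 1) _ _ (fun z => cnorm (p z) (q z))).
- move=> x _; apply: integrable_rephase => //; exact: measurable_funM.
- apply: aeW => z _ x _.
  have d : derivable (rephase (p z) (q z)) (x * X z) 1.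
    by have [] := is_derive_rephase (p z) (q z) (x * X z).
  have c1 : {for x, continuous (fun x : R => x * X z)}.
    by apply: cvgMl; exact: cvg_id.
  have c2 : {for x * X z, continuous (rephase (p z) (q z))}.
    by apply: differentiable_continuous; exact/derivable1_diffP.
  by have := continuous_comp c1 c2.
- exact: integrable_cnorm.
- by move=> x _; apply: aeW => z _; exact: rephase_le.
- by rewrite inE/= in_itv/= gtrBl ltrDl ltr01.
Qed.

(** Using (A + B)^2 <= 2 (A^2 + B^2) for both components gives 4 (A^2 + B^2), and the prefactors 1 /
    (2 k) and 1 / (2 pi) leave 1 / (pi k). Without the cross term every k-integral is elementary. *)
Lemma half_inv_integrand_le (R : realType) (x1 x2 A B k : R) :
  0 < k -> `|x1| <= A + B -> `|x2| <= A + B ->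
  (2 * k)^-1 * (((Num.sqrt (2 * pi))^-1 * x1) ^+ 2 +
                ((Num.sqrt (2 * pi))^-1 * x2) ^+ 2) <=
  (A ^+ 2 + B ^+ 2) / (pi * k).
Proof.
move=> k0 H1 H2; have p0 : 0 < pi :> R := pi_gt0 R.
have sq (x : R) : `|x| <= A + B -> x ^+ 2 <= 2 * (A ^+ 2 + B ^+ 2).
  move=> Hx; apply: (@le_trans _ _ ((A + B) ^+ 2)).
    by rewrite -[x ^+ 2]real_normK ?num_real// ler_sqr ?nnegrE// (le_trans _ Hx).
  by have := sqr_ge0 (A - B); lra.
rewrite !exprMn -mulrDr exprVn sqr_sqrtr; last by rewrite mulr_ge0// ltW.
have -> : (A ^+ 2 + B ^+ 2) / (pi * k) =
    (2 * k)^-1 * ((2 * pi)^-1 * (4 * (A ^+ 2 + B ^+ 2))).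
  by move: (@pi R) p0 => P P0; field; rewrite !gt_eqF.
rewrite !ler_pM2l ?invr_gt0 ?mulr_gt0//.
by have := sq _ H1; have := sq _ H2; lra.
Qed.

(** The ranges up to 1, from 1 to k0 and beyond k0 are estimated separately. The a k terms of the
    first two give a^2 / 2 and a^2 (k0^2 - 1) / 2, which join to a^2 k0^2 / 2. *)
Lemma half_inv_int_le (R : realType) (H1 H2 : R -> R)
    (a beta gamma m delta alpha h k0 : R) :
  continuous H1 -> continuous H2 ->
  1 < k0 -> 1 / 2 < alpha -> 0 < h + ln k0 / 2 ->
  (forall k, 0 < k <= 1 -> `|H1 k| <= a * k + beta * k `^ 4^-1 /\
                           `|H2 k| <= a * k + beta * k `^ 4^-1) ->
  (forall k, 1 <= k <= k0 -> `|H1 k| <= a * k + gamma /\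
                             `|H2 k| <= a * k + gamma) ->
  (forall k, k0 <= k ->
     `|H1 k| <= m / Num.sqrt k + delta * (h + ln k / 2) `^ (- alpha) /\
     `|H2 k| <= m / Num.sqrt k + delta * (h + ln k / 2) `^ (- alpha)) ->
  (half_inv_int (fun k : R => (Num.sqrt (2 * pi))^-1 * H1 k)%R
                (fun k : R => (Num.sqrt (2 * pi))^-1 * H2 k)%R <=
   ((a ^+ 2 * k0 ^+ 2 / 2 + 2 * beta ^+ 2 + gamma ^+ 2 * ln k0 + m ^+ 2 / k0 +
    2 * delta ^+ 2 / (2 * alpha - 1) * (h + ln k0 / 2) `^ (1 - 2 * alpha))
    / pi)%:E)%E.
Proof.
move=> cH1 cH2 k01 al hk0 low mid high.
have p0 : 0 < pi :> R := pi_gt0 R.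
have k00 : 0 < k0 by exact: lt_trans k01.
set s := (Num.sqrt (2 * pi))^-1.
pose J k := (2 * k)^-1 * ((s * H1 k) ^+ 2 + (s * H2 k) ^+ 2).
have J0 k : 0 < k -> 0 <= J k.
  by move=> k_gt0; rewrite mulr_ge0 ?invr_ge0 ?mulr_ge0 ?addr_ge0 ?sqr_ge0// ltW.
have mJ : measurable_fun (`]0, +oo[%classic : set R) J.
  apply: open_continuous_measurable_fun => // k.
  rewrite inE/= in_itv/= andbT => k_gt0.
  have c (H : R -> R) : continuous H -> {for k, continuous (fun k => (s * H k) ^+ 2)}.
    move=> cH; have c1 : {for k, continuous (fun k => s * H k)}.
      by apply: cvgMr; exact: cH.
    by have := continuous_comp c1 (@exprn_continuous R 2 (s * H k)).
  apply: cvgM; last by apply: cvgD; exact: c.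
  apply: cvgV; first by rewrite mulf_neq0// gt_eqF.
  by apply: cvgMr; exact: cvg_id.
have mJ' (A : set R) : A `<=` `]0, +oo[ -> measurable_fun A (EFin \o J).
  by move=> sA; apply/measurable_EFinP; apply: measurable_funS mJ.
have sub1 : `]0, 1]%classic `<=` (`]0, +oo[%classic : set R).
  by apply: subset_itvl; rewrite bnd_simp.
have sub2 : `]1, k0]%classic `<=` (`]0, +oo[%classic : set R).
  by move=> x /=; rewrite !in_itv/= andbT => /andP[/(lt_trans _) ->].
have sub3 : `]k0, +oo[%classic `<=` (`]0, +oo[%classic : set R).
  by apply: subset_itvr; rewrite bnd_simp ltW.
have split3 : `]0, +oo[%classic =
    `]0, 1]%classic `|` (`]1, k0]%classic `|` `]k0, +oo[%classic) :> set R.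
  rewrite -itv_bndbnd_setU ?bnd_simp ?ltW//.
  by rewrite -itv_bndbnd_setU ?bnd_simp.
have disj (x : R) (b c : itv_bound R) :
    [disjoint [set` Interval b (BRight x)] & [set` Interval (BRight x) c]].
  apply/disj_setPRL => y yc yb.
  have : y \in Interval (BRight x) c by exact: yc.
  rewrite itv_boundlr => /andP[xy _].
  have : y \in Interval b (BRight x) by exact: yb.
  rewrite itv_boundlr => /andP[_ yx].
  by have := le_trans yx xy; rewrite bnd_simp ltxx.
have sub23 : `]1, k0]%classic `|` `]k0, +oo[%classic `<=` (`]0, +oo[%classic : set R).
  by rewrite subUset.
have pos1 (x : R) : `]0, +oo[%classic x -> (0 <= (J x)%:E)%E.
  by rewrite /= in_itv/= andbT lee_fin; exact: J0.
have -> : half_inv_int (fun k => s * H1 k) (fun k => s * H2 k) =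
    (\int[mu]_(k in `]0%R, 1%R]) (J k)%:E +
     (\int[mu]_(k in `]1%R, k0]) (J k)%:E + \int[mu]_(k in `]k0, +oo[) (J k)%:E))%E.
  pose B : set R := `]1, k0]%classic `|` `]k0, +oo[%classic.
  have mB : measurable (B : set (measurableTypeR R)) by exact: measurableU.
  have mJB : measurable_fun B (EFin \o J) by exact: mJ'.
  have JB x : B x -> (0 <= (J x)%:E)%E by move=> /sub23; exact: pos1.
  have mJA : measurable_fun (`]0, 1]%classic `|` B) (EFin \o J).
    by rewrite -split3; exact: mJ'.
  have JA x : (`]0, 1]%classic `|` B) x -> (0 <= (J x)%:E)%E.
    by rewrite -split3; exact: pos1.
  have dAB : [disjoint `]0, 1]%classic & B].
    by rewrite /B -itv_bndbnd_setU ?bnd_simp ?ltW//; exact: disj.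
  have dB : [disjoint `]1, k0]%classic & `]k0, +oo[%classic :> set R] by exact: disj.
  rewrite /half_inv_int split3 -/B ge0_integral_setU//; congr (_ + _)%E.
  by rewrite /B ge0_integral_setU.
have I1 : (\int[mu]_(k in `]0%R, 1%R]) (J k)%:E <=
    (a ^+ 2 / pi / 2 + 2 * (beta ^+ 2 / pi))%:E)%E.
  apply: le_trans (integral_01_le _ _); last 2 first.
  - by rewrite divr_ge0 ?sqr_ge0 ?ltW.
  - by rewrite divr_ge0 ?sqr_ge0 ?ltW.
  apply: ge0_le_integral => //.
  - by move=> x /sub1; exact: pos1.
  - exact: mJ'.
  - apply/measurable_EFinP; apply: measurable_funTS; apply: measurable_funD.
      exact: measurable_funM.
    by apply: measurable_funM => //; exact: measurable_powR.
  move=> k /=; rewrite in_itv/= => /andP[k_gt0 k1]; rewrite lee_fin.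
  have [b1 b2] := low k (introT andP (conj k_gt0 k1)).
  apply: le_trans (half_inv_integrand_le k_gt0 b1 b2) _.
  (* Exhibits k^(-1/2) as the square of k^(1/4) divided by k. *)
  have -> : - 2^-1 = (4^-1 + 4^-1) - 1 :> R by field.
  rewrite powRB ?(gt_eqF k_gt0) ?implybT// powRr1 ?(ltW k_gt0)//.
  rewrite powRD ?(gt_eqF k_gt0) ?implybT// le_eqVlt; apply/orP; left; apply/eqP.
  by move: (@pi R) p0 => P P0; field; rewrite !gt_eqF.
have I2 : (\int[mu]_(k in `]1%R, k0]) (J k)%:E <=
    (a ^+ 2 / pi * (k0 ^+ 2 - 1) / 2 + gamma ^+ 2 / pi * ln k0)%:E)%E.
  (* A point has measure 0, so the range may be closed at 1 to match the interval of the explicit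
     formula. *)
  rewrite -integral_1k_le// integral_itv_obnd_cbnd; last exact: mJ'.
  have sub2' : `[1, k0]%classic `<=` (`]0, +oo[%classic : set R).
    by move=> x /=; rewrite !in_itv/= andbT => /andP[/(lt_le_trans _) ->].
  apply: ge0_le_integral => //.
  - by move=> x /sub2'; exact: pos1.
  - exact: mJ'.
  - apply/measurable_EFinP; apply: subspace_continuous_measurable_fun => //.
    apply: continuous_in_subspaceT => x /[!inE]/= /sub2'.
    rewrite /= in_itv/= andbT => x0.
    apply: cvgD; first by apply: cvgMr; exact: cvg_id.
    by apply: cvgMr; apply: cvgV; [rewrite gt_eqF|exact: cvg_id].
  move=> k k1k0; have := sub2' k k1k0; rewrite /= in_itv/= andbT => k_gt0.
  have [b1 b2] := mid k k1k0; rewrite lee_fin.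
  apply: le_trans (half_inv_integrand_le k_gt0 b1 b2) _.
  rewrite le_eqVlt; apply/orP; left; apply/eqP.
  by move: (@pi R) p0 => P P0; field; rewrite !gt_eqF.
have I3 : (\int[mu]_(k in `]k0, +oo[) (J k)%:E <=
    (m ^+ 2 / pi / k0 + 2 * (delta ^+ 2 / pi) / (2 * alpha - 1) *
     (h + ln k0 / 2) `^ (- (2 * alpha - 1)))%:E)%E.
  have al0 : 0 < 2 * alpha - 1 by lra.
  have c1 : 0 <= m ^+ 2 / pi by rewrite divr_ge0 ?sqr_ge0 ?ltW.
  have c2 : 0 <= delta ^+ 2 / pi by rewrite divr_ge0 ?sqr_ge0 ?ltW.
  rewrite -(integral_ky_eq c1 c2 al0 k00 hk0) integral_itv_obnd_cbnd; last exact: mJ'.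
  have sub3' : `[k0, +oo[%classic `<=` (`]0, +oo[%classic : set R).
    by apply: subset_itvr; rewrite bnd_simp.
  apply: ge0_le_integral => //.
  - by move=> x /sub3'; exact: pos1.
  - exact: mJ'.
  - apply/measurable_EFinP; apply: subspace_continuous_measurable_fun => //.
    apply: continuous_in_subspaceT => x /[!inE]/= xk0.
    have := sub3' x xk0; rewrite /= in_itv/= andbT => x0.
    apply: continuous_ky_integrand => //; rewrite (lt_le_trans hk0)// lerD2l.
    move: xk0; rewrite in_itv/= andbT => xk0.
    by rewrite ler_pM2r ?invr_gt0// ler_ln.
  move=> k /= kk0; have := sub3' k kk0; rewrite /= in_itv/= andbT => k_gt0.
  move: kk0; rewrite in_itv/= andbT => kk0.
  have [b1 b2] := high k kk0; rewrite lee_fin.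
  apply: le_trans (half_inv_integrand_le k_gt0 b1 b2) _.
  have Z0 : 0 < h + ln k / 2.
    by rewrite (lt_le_trans hk0)// lerD2l ler_pM2r ?invr_gt0// ler_ln.
  have -> : - (2 * alpha - 1) - 1 = - alpha + - alpha by ring.
  rewrite powRD ?(gt_eqF Z0) ?implybT//.
  rewrite !exprMn exprVn sqr_sqrtr ?(ltW k_gt0)// le_eqVlt.
  apply/orP; left; apply/eqP.
  by move: (@pi R) p0 => P P0; field; rewrite !gt_eqF.
apply: le_trans (leeD I1 (leeD I2 I3)) _; rewrite -!EFinD lee_fin.
have -> : - (2 * alpha - 1) = 1 - 2 * alpha by ring.
have al0 : 0 < 2 * alpha - 1 by lra.
rewrite le_eqVlt; apply/orP; left; apply/eqP.
by move: (@pi R) p0 => P P0; field; rewrite !gt_eqF.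
Qed.

(** * Comparison with the constants of the stated bound *)

Lemma powRN_antitone (R : realType) (s x y : R) :
  0 <= s -> 0 < x -> x <= y -> y `^ (- s) <= x `^ (- s).
Proof.
move=> s0 x0 xy; have y0 := lt_le_trans x0 xy.
by rewrite !powRN lef_pV2 ?posrE ?powR_gt0// ge0_ler_powR// nnegrE ltW.
Qed.

(** Both products of exponentials collapse to e^(- b). The coefficients 1/2 and 16 together stay
    below 20, and e^(4 L) and 2^(1 + alpha) are at least 1. *)
Lemma exponential_terms_le (R : realType) (C L alpha b A1 A2 : R) :
  0 <= C -> 0 <= A1 -> 0 <= A2 -> 0 <= L -> 0 <= alpha ->
  (expR (- b) * A1) ^+ 2 * expR (b / 2) ^+ 2 / 2 +
  (4 * expR (- (b / 4)) * (C + A1 + A2)) ^+ 2 / expR (b / 2) <=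
  20 * expR (4 * L - b) * (2 `^ (1 + alpha) * C + A1 + A2) ^+ 2.
Proof.
move=> C0 A10 A20 L0 a0.
have e1 : expR (- b) ^+ 2 * expR (b / 2) ^+ 2 = expR (- b).
  by rewrite -!expRM_natl -expRD; congr expR; field.
have e2 : expR (- (b / 4)) ^+ 2 / expR (b / 2) = expR (- b).
  by rewrite -expRN -!expRM_natl -expRD; congr expR; field.
have -> : (expR (- b) * A1) ^+ 2 * expR (b / 2) ^+ 2 / 2 +
  (4 * expR (- (b / 4)) * (C + A1 + A2)) ^+ 2 / expR (b / 2) =
  (expR (- b) ^+ 2 * expR (b / 2) ^+ 2) * (A1 ^+ 2 / 2) +
  (expR (- (b / 4)) ^+ 2 / expR (b / 2)) * (16 * (C + A1 + A2) ^+ 2).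
  by field; rewrite gt_eqF// expR_gt0.
rewrite e1 e2 -mulrDr.
have eL : expR (- b) <= expR (4 * L - b) by rewrite ler_expR; lra.
have two : 1 <= 2 `^ (1 + alpha) :> R.
  by rewrite -[leLHS](powRr0 2) ler_powR ?ler1n// addr_ge0.
have CM : C <= 2 `^ (1 + alpha) * C by rewrite ler_peMl.
set M := 2 `^ (1 + alpha) * C + A1 + A2.
have M1 : (C + A1 + A2) ^+ 2 <= M ^+ 2.
  by rewrite ler_sqr ?nnegrE /M; lra.
have M2 : A1 ^+ 2 <= M ^+ 2 by rewrite ler_sqr ?nnegrE /M; lra.
have -> : 20 * expR (4 * L - b) * M ^+ 2 = expR (4 * L - b) * (20 * M ^+ 2) by ring.
have := sqr_ge0 M; have := sqr_ge0 (C + A1 + A2); have := sqr_ge0 A1 => h1 h2 h3.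
by apply: ler_pM; rewrite ?expR_ge0//; lra.
Qed.

(** With D = 1 / (alpha (2 alpha - 1)) and X = x^(1 - 2 alpha) the right-hand side is 16 C^2 D X, of
    which the three summands take 8, 4 and 4. *)
Lemma power_terms_le (R : realType) (C alpha b x : R) :
  0 <= C -> 1 / 2 < alpha -> 4 <= b -> 0 < x -> x <= 3 * b / 4 ->
  2 * (2 * C * b `^ (- (alpha - 4^-1)) / (alpha - 4^-1)) ^+ 2 +
  (2 * C * b `^ (- alpha) / alpha) ^+ 2 * (b / 2) +
  2 * (C / alpha) ^+ 2 / (2 * alpha - 1) * (3 * b / 4) `^ (1 - 2 * alpha) <=
  2 * ((alpha * (2 * alpha - 1))^-1 * (8 * C ^+ 2 / x `^ (2 * alpha - 1))).
Proof.
move=> C0 al b4 x0 xb.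
have b0 : 0 < b by lra.
have a0 : 0 < alpha by lra.
have a1 : 0 < 2 * alpha - 1 by lra.
have a2 : 0 < alpha - 4^-1 by lra.
have eN : 1 - 2 * alpha = - (2 * alpha - 1) by ring.
set X := x `^ (- (2 * alpha - 1)).
have X0 : 0 <= X by exact: powR_ge0.
have Xb : b `^ (- (2 * alpha - 1)) <= X by apply: powRN_antitone; lra.
have Xb' : (3 * b / 4) `^ (1 - 2 * alpha) <= X.
  by rewrite eN; apply: powRN_antitone; lra.
have bn0 : (b == 0) = false by rewrite gt_eqF.
have sqb : (b `^ (- alpha)) ^+ 2 * b = b `^ (- (2 * alpha - 1)).
  rewrite expr2 -[X in _ * X](powRr1 (ltW b0)) -!powRD ?bn0 ?implybT//.
  by congr powR; ring.
(* From b >= 4. This halves the first summand, whose power of b has an extra factor b^(-1/2). *)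
have b12 : b `^ (- 2^-1) <= 2^-1.
  rewrite powRN lef_pV2 ?posrE ?powR_gt0// powR12_sqrt ?(ltW b0)//.
  rewrite -[leLHS]ger0_norm// -sqrtr_sqr ler_sqrt ?(ltW b0)//.
  lra.
have sqb' : (b `^ (- (alpha - 4^-1))) ^+ 2 <= X / 2.
  have -> : (b `^ (- (alpha - 4^-1))) ^+ 2 = b `^ (- (2 * alpha - 1)) * b `^ (- 2^-1).
    by rewrite expr2 -!powRD ?bn0 ?implybT//; congr powR; field.
  by apply: ler_pM; rewrite ?powR_ge0.
set D := (alpha * (2 * alpha - 1))^-1.
have D0 : 0 <= D by rewrite invr_ge0 mulr_ge0// ltW.
have D2 : 2 * D = (2^-1 * (alpha * (2 * alpha - 1)))^-1.
  by rewrite invfM invrK.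
(* Completing the square: (alpha - 1/4)^2 exceeds alpha (2 alpha - 1) / 2 by exactly 1/16. *)
have d1 : (alpha - 4^-1) ^- 2 <= 2 * D.
  rewrite D2 lef_pV2 ?posrE ?exprn_gt0 ?mulr_gt0 ?invr_gt0//.
  have -> : (alpha - 4^-1) ^+ 2 = 2^-1 * (alpha * (2 * alpha - 1)) + 16^-1 by field.
  by rewrite lerDl invr_ge0.
have d2 : alpha ^- 2 <= 2 * D.
  rewrite D2 lef_pV2 ?posrE ?exprn_gt0 ?mulr_gt0 ?invr_gt0//.
  have -> : alpha ^+ 2 = 2^-1 * (alpha * (2 * alpha - 1)) + 2^-1 * alpha by field.
  by rewrite lerDl mulr_ge0 ?invr_ge0 ?(ltW a0).
have d3 : alpha ^- 2 / (2 * alpha - 1) <= 2 * D.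
  have -> : alpha ^- 2 / (2 * alpha - 1) = alpha^-1 * D.
    by rewrite /D; field; rewrite !gt_eqF.
  by rewrite ler_wpM2r// -[2]invrK lef_pV2 ?posrE ?invr_gt0//; lra.
have -> : 2 * (D * (8 * C ^+ 2 / x `^ (2 * alpha - 1))) = 16 * C ^+ 2 * (D * X).
  by rewrite /X powRN; ring.
have C2 : 0 <= C ^+ 2 by exact: sqr_ge0.
have t1 : 2 * (2 * C * b `^ (- (alpha - 4^-1)) / (alpha - 4^-1)) ^+ 2 <=
    8 * C ^+ 2 * (D * X).
  have -> : 2 * (2 * C * b `^ (- (alpha - 4^-1)) / (alpha - 4^-1)) ^+ 2 =
    8 * C ^+ 2 * ((alpha - 4^-1) ^- 2 * (b `^ (- (alpha - 4^-1))) ^+ 2).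
    by rewrite !exprMn exprVn; ring.
  rewrite ler_wpM2l ?mulr_ge0//.
  have -> : D * X = (2 * D) * (X / 2) by field.
  by apply: ler_pM; rewrite ?invr_ge0 ?sqr_ge0.
have t2 : (2 * C * b `^ (- alpha) / alpha) ^+ 2 * (b / 2) <= 4 * C ^+ 2 * (D * X).
  have -> : (2 * C * b `^ (- alpha) / alpha) ^+ 2 * (b / 2) =
    2 * C ^+ 2 * (alpha ^- 2 * ((b `^ (- alpha)) ^+ 2 * b)).
    by rewrite !exprMn exprVn; field; rewrite gt_eqF.
  have -> : 4 * C ^+ 2 * (D * X) = 2 * C ^+ 2 * ((2 * D) * X) by ring.
  rewrite ler_wpM2l ?mulr_ge0// sqb.
  by apply: ler_pM; rewrite ?invr_ge0 ?sqr_ge0 ?powR_ge0.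
have t3 : 2 * (C / alpha) ^+ 2 / (2 * alpha - 1) * (3 * b / 4) `^ (1 - 2 * alpha) <=
    4 * C ^+ 2 * (D * X).
  have -> : 2 * (C / alpha) ^+ 2 / (2 * alpha - 1) * (3 * b / 4) `^ (1 - 2 * alpha) =
    2 * C ^+ 2 * ((alpha ^- 2 / (2 * alpha - 1)) * (3 * b / 4) `^ (1 - 2 * alpha)).
    by rewrite !exprMn exprVn; ring.
  have -> : 4 * C ^+ 2 * (D * X) = 2 * C ^+ 2 * ((2 * D) * X) by ring.
  rewrite ler_wpM2l ?mulr_ge0//.
  apply: ler_pM; rewrite ?powR_ge0//.
  by rewrite mulr_ge0 ?invr_ge0 ?sqr_ge0 ?(ltW a1).
lra.
Qed.

(** * From the shifted function to the final estimate *)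

(** The substitution z = y - yo moves the shift from f into the phase; the imaginary part is written
    as the real part belonging to - i f. *)
Lemma shifted_BogE (R : realType) (fr fi : R -> R) (yo : R) :
  cintegrable fr fi ->
  Bog_re (fshift fr yo) (fshift fi yo) = (fun k => (Num.sqrt (2 * pi))^-1 *
    Rintegral mu setT (fun z => rephase (fr z) (fi z) (k * xmap (z - - yo)))) /\
  Bog_im (fshift fr yo) (fshift fi yo) = (fun k => (Num.sqrt (2 * pi))^-1 *
    Rintegral mu setT (fun z => rephase (fi z) (- fr z) (k * xmap (z - - yo)))).
Proof.
move=> ipq; have [ifr ifi] := ipq.
have ipq' : cintegrable fi (fun z => - fr z).
  by split => //; exact: (integrableN ifr).
split; apply/funext => k; [rewrite /Bog_re|rewrite /Bog_im].
- apply: (congr1 (fun t => (Num.sqrt (2 * pi))^-1 * t)).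
  rewrite -(Rintegral_translation (- yo)
    (integrable_rephase ipq (measurable_phase k (- yo)))).
  by apply: eq_Rintegral => y _; rewrite addrK.
- apply: (congr1 (fun t => (Num.sqrt (2 * pi))^-1 * t)).
  rewrite -(Rintegral_translation (- yo)
    (integrable_rephase ipq' (measurable_phase k (- yo)))).
  by apply: eq_Rintegral => y _; rewrite addrK /rephase mulNr opprK.
Qed.

(** At the argument - k the Fourier kernel is e^(i k z), with the sign of the phase e^(i k x(z));
    the nonzero normalising factor can be cancelled. *)
Lemma FT_vanishes_neg (R : realType) (fr fi : R -> R) (k : R) :
  FT_re fr fi (- k) = 0 /\ FT_im fr fi (- k) = 0 ->
  Rintegral mu setT (fun z => rephase (fr z) (fi z) (k * z)) = 0 /\
  Rintegral mu setT (fun z => rephase (fi z) (- fr z) (k * z)) = 0.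
Proof.
have s0 : (Num.sqrt (2 * pi))^-1 != 0 :> R.
  by rewrite invr_eq0 gt_eqF// sqrtr_gt0 mulr_gt0// pi_gt0.
move=> [/eqP + /eqP]; rewrite /FT_re /FT_im !mulf_eq0 (negbTE s0)/=.
move=> /eqP h1 /eqP h2; split.
- rewrite -[RHS]h1; apply: eq_Rintegral => z _.
  have -> : - k * z = - (k * z) by rewrite mulNr.
  by rewrite /rephase cosN sinN mulrN.
- rewrite -[RHS]h2; apply: eq_Rintegral => z _.
  have -> : - k * z = - (k * z) by rewrite mulNr.
  by rewrite /rephase cosN sinN mulNr mulrN.
Qed.

Unset Implicit Arguments. Set Strict Implicit.

Theorem theorem5 (R : realType) (fr fi fr' fi' : R -> R) (C L alpha : R) :
  (* Fourier transform of f vanishes for negative arguments *)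
  (forall p : R, p < 0 -> FT_re fr fi p = 0 /\ FT_im fr fi p = 0) ->
  (* normalisation *)
  KG_norm fr fi = 1%E ->
  (* f is differentiable with derivative f' = fr' + i fi' *)
  (forall y : R, is_derive y 1 fr (fr' y)) ->
  (forall y : R, is_derive y 1 fi (fi' y)) ->
  (* f and f' integrable *)
  cintegrable fr fi ->
  cintegrable fr' fi' ->
  0 < C -> 1 <= L -> 1 / 2 < alpha ->
  (forall y : R, L <= y ->
     Num.sqrt (fr y ^+ 2 + fi y ^+ 2) <= C / (y `^ (1 + alpha))) ->
  forall yo : R, yo <= - 4 * (1 + L) ->
  (Nbar (fshift fr yo) (fshift fi yo) <=
   ((alpha * (2 * alpha - 1))^-1 *
      (8 * C ^+ 2 / ((- yo / 4 + L / 2 - 1) `^ (2 * alpha - 1)))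
    + 20 * expR (4 * L + yo / 2) *
      ((2 `^ (1 + alpha)) * C + L1norm fr fi + L1norm fr' fi') ^+ 2)%:E)%E.
Proof.
move=> FT0 _ dfr dfi ipq ip'q' C0 L1 al dec yo yoL.
(* Half of T = - yo: left of [b] the phase error is of order e^(b - T) = e^(- b), and right of it f
   has already decayed. *)
pose b := - yo / 2.
have Tb : - yo = 2 * b by rewrite /b; field.
have bL : 2 * (1 + L) <= b by rewrite /b; lra.
have a0 : 0 < alpha by lra.
set A1 := L1norm fr fi; set A2 := L1norm fr' fi'.
have A1_ge0 : 0 <= A1 by apply: Rintegral_ge0 => x _; exact: sqrtr_ge0.
have A2_ge0 : 0 <= A2 by apply: Rintegral_ge0 => x _; exact: sqrtr_ge0.
pose T := - yo.
pose H p q k := Rintegral mu setT (fun z => rephase (p z) (q z) (k * xmap (z - T))).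
(* The imaginary part of the transform of f is the real part of that of - i f. *)
pose fr_ z := - fr z; pose fr_' z := - fr' z.
have ipq_ : cintegrable fi fr_ by have [i j] := ipq; split => //; exact: (integrableN i).
have ipq_' : cintegrable fi' fr_'.
  by have [i j] := ip'q'; split => //; exact: (integrableN i).
have dfr_ (y : R) : is_derive y 1 fr_ (fr_' y) by exact: is_deriveN.
have cnE (x y : R) : cnorm y (- x) = cnorm x y by rewrite sqrrN addrC.
have A1E : Rintegral mu setT (fun z => cnorm (fi z) (fr_ z)) = A1.
  by apply: eq_Rintegral => z _; rewrite cnE.
have A2E : Rintegral mu setT (fun z => cnorm (fi' z) (fr_' z)) = A2.
  by apply: eq_Rintegral => z _; rewrite cnE.
have decp z : L <= z -> cnorm (fr z) (fi z) <= C * z `^ (- alpha - 1).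
  move=> Lz; apply: (le_trans (dec z Lz)).
  by rewrite -powRN opprD addrC.
have decp_ z : L <= z -> cnorm (fi z) (fr_ z) <= C * z `^ (- alpha - 1).
  by rewrite cnE; exact: decp.
have van k : 0 < k -> Rintegral mu setT (fun z => rephase (fr z) (fi z) (k * z)) = 0 /\
    Rintegral mu setT (fun z => rephase (fi z) (fr_ z) (k * z)) = 0.
  by move=> k0; apply: FT_vanishes_neg; apply: FT0; rewrite oppr_lt0.
(* A second multiplication by - i leads to - f, whose real part changes sign only. *)
have van_ k : 0 < k -> Rintegral mu setT (fun z => rephase (fr_ z) (- fi z) (k * z)) = 0.
  move=> k0; have mk : measurable_fun setT (fun z : R => k * z) by exact: measurable_funM.
  have := RintegralZl (- 1) measurableT (integrable_rephase ipq mk).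
  rewrite (van k k0).1 mulr0 => <-; apply: eq_Rintegral => z _.
  by rewrite /rephase /fr_; ring.
have bT : b - T = - b by rewrite /T Tb; ring.
have b_ge1 : 1 <= b by lra.
have b_gt0 : 0 < b by lra.
have T1 : 1 <= T by rewrite /T Tb; lra.
have al4 : 4^-1 < alpha by lra.
have bdec (p q : R -> R) :
    (forall z, L <= z -> cnorm (p z) (q z) <= C * z `^ (- alpha - 1)) ->
    forall z, b <= z -> cnorm (p z) (q z) <= C * z `^ (- alpha - 1).
  by move=> h z bz; apply: h; lra.
rewrite /Nbar; have [-> ->] := shifted_BogE yo ipq.
have cH : continuous (H fr fi).
  by apply: continuous_rephase_integral => //; have := measurable_phase 1 T;
    under eq_fun do rewrite mul1r.
have cH_ : continuous (H fi fr_).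
  by apply: continuous_rephase_integral => //; have := measurable_phase 1 T;
    under eq_fun do rewrite mul1r.
(* The threshold k0 = e^(b / 2): there k e^(- b) is still only e^(- b / 2), and the cut point of the
   high range is 3 b / 4. *)
have k01 : 1 < expR (b / 2) by rewrite expR_gt1 divr_gt0.
have Z34 : b / 2 + ln (expR (b / 2)) / 2 = 3 * b / 4 by rewrite expRK; field.
have Z0 : 0 < b / 2 + ln (expR (b / 2)) / 2 by rewrite Z34; lra.
have low k : 0 < k <= 1 ->
    `|H fr fi k| <= expR (- b) * A1 * k +
      2 * C * b `^ (- (alpha - 4^-1)) / (alpha - 4^-1) * k `^ 4^-1 /\
    `|H fi fr_ k| <= expR (- b) * A1 * k +
      2 * C * b `^ (- (alpha - 4^-1)) / (alpha - 4^-1) * k `^ 4^-1.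
  move=> /andP[k0 _]; have [v1 v2] := van k k0.
  have B1 := rephase_integral_verylow ipq k0 b_ge1 T1 (ltW C0) al4 v1 v2
    (bdec _ _ decp).
  have B2 := rephase_integral_verylow ipq_ k0 b_ge1 T1 (ltW C0) al4 v2 (van_ k k0)
    (bdec _ _ decp_).
  rewrite A1E in B2; rewrite -/A1 -/(L1norm fr fi) in B1; move: B1 B2.
  rewrite bT -/(H _ _ k) => B1 B2; split.
    by apply: le_trans B1 _; rewrite -/A1; lra.
  by apply: le_trans B2 _; lra.
have mid k : 1 <= k <= expR (b / 2) ->
    `|H fr fi k| <= expR (- b) * A1 * k + 2 * C * b `^ (- alpha) / alpha /\
    `|H fi fr_ k| <= expR (- b) * A1 * k + 2 * C * b `^ (- alpha) / alpha.
  move=> /andP[k1 _]; have k0 : 0 < k by exact: lt_le_trans k1.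
  have [v1 v2] := van k k0.
  have B1 := rephase_integral_low T ipq k0 b_gt0 (ltW C0) a0 v1 v2 (bdec _ _ decp).
  have B2 := rephase_integral_low T ipq_ k0 b_gt0 (ltW C0) a0 v2 (van_ k k0)
    (bdec _ _ decp_).
  rewrite A1E in B2; move: B1 B2; rewrite bT -/(H _ _ k) => B1 B2; split.
    by apply: le_trans B1 _; rewrite -/(L1norm fr fi) -/A1; lra.
  by apply: le_trans B2 _; lra.
have high k : expR (b / 2) <= k ->
    `|H fr fi k| <= 4 * expR (- (b / 4)) * (C + A1 + A2) / Num.sqrt k +
      C / alpha * (b / 2 + ln k / 2) `^ (- alpha) /\
    `|H fi fr_ k| <= 4 * expR (- (b / 4)) * (C + A1 + A2) / Num.sqrt k +
      C / alpha * (b / 2 + ln k / 2) `^ (- alpha).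
  move=> kb; have k0 : 0 < k by exact: lt_le_trans (expR_gt0 _) kb.
  have lnk : b / 2 <= ln k by rewrite -[leLHS]expRK ler_ln ?posrE ?expR_gt0.
  (* The cut moves right with k, so that the tail becomes square integrable against dk / k, while
     e^Z grows only like the square root of k, less than the gain 1 / k. *)
  pose Z := b / 2 + ln k / 2.
  have Z1 : 1 <= Z by rewrite /Z; lra.
  have ZL : L <= Z by rewrite /Z; lra.
  have Zdec (p q : R -> R) :
      (forall z, L <= z -> cnorm (p z) (q z) <= C * z `^ (- alpha - 1)) ->
      forall z, Z <= z -> cnorm (p z) (q z) <= C * z `^ (- alpha - 1).
    by move=> h z Zz; apply: h; exact: le_trans Zz.
  have B1 := rephase_integral_high T dfr dfi ipq ip'q' k0 Z1 (ltW C0) a0 (Zdec _ _ decp).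
  have B2 := rephase_integral_high T dfi dfr_ ipq_ ipq_' k0 Z1 (ltW C0) a0
    (Zdec _ _ decp_).
  rewrite A1E A2E in B2.
  (* Since ln k >= b / 2, both 1 and e^(Z - T) are at most e^(- b / 4) times the square root of
     k. *)
  have wZ : (1 + expR (Z - T)) / k <= 2 * expR (- (b / 4)) / Num.sqrt k.
    have sk : Num.sqrt k = expR (ln k / 2).
      by rewrite -powR12_sqrt ?(ltW k0)// /powR gt_eqF// mulrC.
    have kk : k = Num.sqrt k * Num.sqrt k by rewrite -expr2 sqr_sqrtr ?(ltW k0).
    rewrite {1}kk invfM mulrA ler_pM2r ?invr_gt0 ?sk ?expR_gt0//.
    rewrite ler_pdivrMr ?expR_gt0// -mulrA -expRD.
    have : 1 <= expR (- (b / 4) + ln k / 2).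
      by rewrite -[leLHS]expR0 ler_expR; lra.
    have : expR (Z - T) <= expR (- (b / 4) + ln k / 2).
      by rewrite ler_expR /Z /T Tb; lra.
    lra.
  have M0 : 0 <= C + A1 + A2 by rewrite !addr_ge0// ltW.
  have := ler_wpM2r M0 wZ => wM.
  split.
    apply: le_trans B1 _; rewrite -/(L1norm fr fi) -/(L1norm fr' fi') -/A1 -/A2 -/Z.
    lra.
  by apply: le_trans B2 _; rewrite -/Z; lra.
have N_le := half_inv_int_le cH cH_ k01 al Z0 low mid high.
apply: (le_trans N_le); rewrite lee_fin Z34 expRK.
have pi2 : 2 <= pi :> R by exact: pi_ge2.
have p0 : 0 < pi :> R by exact: pi_gt0.
(* Equal to b / 2 + L / 2 - 1. From b >= 2 (1 + L) it is positive and at most 3 b / 4, so negative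
   powers of b and 3 b / 4 are bounded by those of x. *)
pose x := - yo / 4 + L / 2 - 1.
have x0 : 0 < x by rewrite /x; move: bL; rewrite /b; lra.
have xb : x <= 3 * b / 4 by rewrite /x; move: bL; rewrite /b; lra.
have b4 : 4 <= b by lra.
have E1 := power_terms_le (ltW C0) al b4 x0 xb.
have L0 : 0 <= L by lra.
have E2 := exponential_terms_le b (ltW C0) A1_ge0 A2_ge0 L0 (ltW a0).
have eyo : 4 * L + yo / 2 = 4 * L - b by rewrite /b; lra.
rewrite eyo -/x ler_pdivrMr//.
have P1 : 0 <= (alpha * (2 * alpha - 1))^-1 * (8 * C ^+ 2 / x `^ (2 * alpha - 1)).
  apply: mulr_ge0; first by rewrite invr_ge0 mulr_ge0//; lra.
  apply: divr_ge0; last exact: powR_ge0.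
  by apply: mulr_ge0; last exact: sqr_ge0.
have P2 : 0 <= 20 * expR (4 * L - b) * (2 `^ (1 + alpha) * C + A1 + A2) ^+ 2.
  by apply: mulr_ge0; [apply: mulr_ge0; rewrite ?expR_ge0|exact: sqr_ge0].
move: E1 E2 P1 P2.
set U := (_^-1 * (8 * _ / _)); set V := 20 * _ * _.
move=> E1 E2 P1 P2.
(* The power terms were bounded by 2 U and the exponential ones by V; dividing by pi >= 2 supplies
   the missing factor 1/2. *)
have : 2 * (U + V) <= (U + V) * pi by rewrite mulrC ler_wpM2l// addr_ge0.
lra.
Qed.
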